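(* Let $a < b$ be real numbers, let $f \in C[a,b]$, and let $\alpha > 0$ with $\alpha \notin \mathbb{N}$. Let $n = \lceil \alpha \rceil$ and $c_\alpha = \frac{\sin \pi\alpha}{\pi} \prod_{\ell=1}^{n-1} \frac{1}{\ell-\alpha}$. Let $\psi : \Omega \to (0,\infty)$ be an admissible transformation. Then, for every $t \in [a,b]$, the Riemann-Liouville integral $J_a^\alpha f(t)$ of order $\alpha$ of $f$ satisfies $$J_a^\alpha f(t) = \int_\Omega \phi(t,\omega)\, \mathrm{d}\omega,$$ where $$\phi(t,\omega) = c_\alpha\, \psi'(\omega)\, (\psi(\omega))^{n-\alpha-1} \int_a^t (t-\tau)^{n-1} \exp(-(t-\tau)\psi(\omega))\, f(\tau)\, \mathrm{d}\tau .$$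
   Context: The Riemann-Liouville integral of order $\alpha > 0$ with starting point $a$ of a function $f \in C[a,b]$ is $J_a^\alpha f(t) = \frac{1}{\Gamma(\alpha)} \int_a^t (t-\tau)^{\alpha-1} f(\tau)\, \mathrm{d}\tau$ for $t \in [a,b]$. A function $\psi : \Omega \to (0,\infty)$ is called an admissible transformation if: (i) its domain $\Omega$ is a non-empty open interval of $\mathbb{R}$ (possibly unbounded); (ii) $\psi \in C^1(\Omega)$; (iii) $\psi$ is strictly monotonically increasing; (iv) $\lim_{\omega \to \inf\Omega} \psi(\omega) = 0$ and $\lim_{\omega \to \sup\Omega} \psi(\omega) = +\infty$. Here $\mathbb{N} = \{1,2,3,\ldots\}$, and an empty product equals $1$. *)

(* Defs.v *)
From HB Require Import structures.
From mathcomp Require Import all_boot all_order all_algebra.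
From mathcomp Require Import all_classical all_reals all_analysis.

Set Implicit Arguments.
Unset Strict Implicit.
Unset Printing Implicit Defensive.

Import Order.TTheory GRing.Theory Num.Theory.
Import numFieldNormedType.Exports.

Local Open Scope classical_set_scope.
Local Open Scope ring_scope.

(* Euler's integral; the intended domain is x > 0, where it converges. *)
Definition Gamma (R : realType) (x : R) : R :=
  \int[lebesgue_measure]_(s in `]0, +oo[) (s `^ (x - 1) * expR (- s)).

(* For alpha < 1 the integrand is singular at tau = t; the junk value taken by
   powR there is irrelevant, since a point is a null set. *)
Definition riemann_liouville (R : realType) (a alpha : R) (f : R -> R)
    (t : R) : R :=
  (Gamma alpha)^-1 *
  \int[lebesgue_measure]_(tau in `[a, t]) ((t - tau) `^ (alpha - 1) * f tau).

(* The filters "omega --> inf Omega" and "omega --> sup Omega", the bounds being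
   taken in the extended reals. They are meant for a non-empty open interval
   Omega: then the bounds do not belong to Omega, the infimum is not +oo and the
   supremum is not -oo, and every set of the filter meets Omega. *)
Definition inf_end (R : realType) (Omega : set R) : set_system R :=
  match ereal_inf (EFin @` Omega) with
  | r%:E => r^'+
  | -oo%E => -oo_R
  | +oo%E => +oo_R
  end.

Definition sup_end (R : realType) (Omega : set R) : set_system R :=
  match ereal_sup (EFin @` Omega) with
  | r%:E => r^'-
  | -oo%E => -oo_R
  | +oo%E => +oo_R
  end.

(* psi is a total function, but only its restriction to Omega matters: as Omega
   is open, the derivative on Omega does not depend on values outside Omega. *)
Record admissible (R : realType) (Omega : set R) (psi : R -> R) : Prop := {
  adm_nonempty : Omega !=set0 ;
  adm_open : open Omega ;
  adm_interval : is_interval Omega ;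
  adm_gt0 : forall w, Omega w -> 0 < psi w ;
  adm_derivable : forall w, Omega w -> derivable psi w 1 ;
  adm_C1 : {within Omega, continuous psi^`()%classic} ;
  adm_incr : forall w1 w2, Omega w1 -> Omega w2 -> w1 < w2 -> psi w1 < psi w2 ;
  adm_inf : psi w @[w --> inf_end Omega] --> (0 : R) ;
  adm_sup : psi w @[w --> sup_end Omega] --> +oo
}.

(* Num.ceil is int-valued; this is the ceiling as a natural number for x >= 0. *)
Definition nceil (R : realType) (x : R) : nat := `|Num.ceil x|%N.

Definition c_coef (R : realType) (alpha : R) : R :=
  sin (pi * alpha) / pi *
  \prod_(1 <= l < nceil alpha) (l%:R - alpha)^-1.

Definition phi (R : realType) (a alpha : R) (f psi : R -> R) (t w : R) : R :=
  let n := nceil alpha in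
  c_coef alpha * psi^`()%classic w * psi w `^ (n%:R - alpha - 1) *
  \int[lebesgue_measure]_(tau in `[a, t])
    ((t - tau) ^+ n.-1 * expR (- ((t - tau) * psi w)) * f tau).

(* Main.v *)
Require Import Defs.
From HB Require Import structures.
From mathcomp Require Import all_boot all_order all_algebra.
From mathcomp Require Import all_classical all_reals all_analysis.
From mathcomp Require Import measurable_realfun ring lra.
Import Order.TTheory GRing.Theory Num.Theory.
Import numFieldNormedType.Exports.
Local Open Scope classical_set_scope.
Local Open Scope ring_scope.

(** The proof is a change of the order of integration. Put [beta = n - alpha],
    a number of [(0, 1)]. The substitution [u = psi w] gives, for [s > 0],
    [int_Omega psi'(w) psi(w)^(beta-1) exp(-s psi(w)) dw
      = int_0^oo u^(beta-1) exp(-s u) du = s^(-beta) Gamma(beta)]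
    ([ray_laplace_powR]), whatever the transformation [psi]. With
    [s = t - tau], integrating [phi(t, .)] over [Omega] before integrating over
    [tau] turns the factor [(t - tau)^(n-1)] into [(t - tau)^(alpha-1)], and
    yields [c_alpha Gamma(beta)] times the integral in the definition of
    [J_a^alpha f(t)]. Fubini's theorem applies ([fubini_rect]) since the same
    computation with absolute values gives the integral of
    [(t - tau)^(alpha-1) |f(tau)|], which is finite as [alpha > 0]
    ([integrable_abel_kernel]).

    What remains is [c_alpha Gamma(alpha) Gamma(n - alpha) = 1]
    ([Gamma_shift_reflection]). By the recurrence of Gamma it is Euler's
    reflection formula [Gamma(x) Gamma(1-x) = pi / sin(pi x)] on [(0, 1)].
    Tonelli's theorem identifies the left side with
    [Beta x = int_0^oo u^(x-1) / (1 + u) du] ([eGamma_reflected]). The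
    difference [h] of [Beta x] and [pi / sin(pi x)] is Lipschitz on [(0, 1)],
    because both functions have the same simple poles [1/x] and [1/(1-x)]
    ([Beta_lipschitz], [csc_reg_lipschitz]), and both satisfy the equation
    [3 h(x) = h(x/3) - h((x+1)/3) + h((x+2)/3)]. This equation divides any
    Lipschitz constant of [h] by 3, so [h] is constant, hence zero
    ([triplication_lipschitz_eq0]). *)

Set Implicit Arguments.
Unset Strict Implicit.
Unset Printing Implicit Defensive.

Local Notation mu := lebesgue_measure.

(** * Parametrisations of the positive half-line *)

(** What the substitution [u = psi w] uses of an admissible transformation: it
    is an increasing [C^1] bijection from the open interval [Omega] onto
    [(0, +oo)]. Surjectivity replaces the two limits, which makes the scalings
    and powers of [(0, +oo)] easy to recognise as further instances. *)
Record ray_param (R : realType) (Omega : set R) (psi : R -> R) : Prop := {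
  ray_open : open Omega ;
  ray_interval : is_interval Omega ;
  ray_gt0 : forall w, Omega w -> 0 < psi w ;
  ray_derivable : forall w, Omega w -> derivable psi w 1 ;
  ray_C1 : forall w, Omega w -> {for w, continuous psi^`()%classic} ;
  ray_incr : {in Omega &, {homo psi : x y / x < y}} ;
  ray_surj : forall y, 0 < y -> exists2 w, Omega w & psi w = y
}.

(** The end filters live on the whole line; openness of [Omega] forces
    the bound [r], if finite, out of [Omega], so that points of [Omega] close
    to [r] lie on its right, where the filter sees them. *)
Lemma inf_end_meets (R : realType) (Omega U : set R) :
  Omega !=set0 -> open Omega -> inf_end Omega U -> exists2 w, Omega w & U w.
Proof.
move=> [w0 Ow0] oO; rewrite /inf_end.
case E : (ereal_inf (EFin @` Omega)) => [r| |].
- case=> e /= e0 eU.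
  have [_ [w Ow <-] wre] : exists2 x, (EFin @` Omega) x & (x < (r + e)%:E)%E.
    by apply: ereal_inf_lt; rewrite E lte_fin ltrDl.
  have rw (x : R) : Omega x -> r <= x.
    by move=> Ox; rewrite -lee_fin -E; apply: ereal_inf_lbound; exists x.
  have nr : ~ Omega r.
    move=> Or; have /nbhs_ballP[d /= d0 dO] : nbhs r Omega by exact: open_nbhs_nbhs.
    have /rw : Omega (r - d / 2).
      apply: dO; rewrite /ball/= opprB addrC subrK ger0_norm ?divr_ge0 ?ltW//.
      by rewrite ltr_pdivrMr// ltr_pMr// ltr1n.
    by rewrite leNgt ltrBlDr ltrDl divr_gt0.
  have rltw : r < w.
    by rewrite lt_neqAle rw// andbT; apply/eqP => rE; apply: nr; rewrite rE.
  exists w => //; apply: eU => //=.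
  by rewrite distrC gtr0_norm ?subr_gt0// ltrBlDl -lte_fin.
- exfalso; have : (ereal_inf (EFin @` Omega) <= w0%:E)%E.
    by apply: ereal_inf_lbound; exists w0.
  by rewrite E.
- case=> M [_ MU].
  have [_ [w Ow <-] wM] : exists2 x, (EFin @` Omega) x & (x < M%:E)%E.
    by apply: ereal_inf_lt; rewrite E ltNyr.
  by exists w => //; apply: MU; rewrite -lte_fin.
Qed.

Lemma sup_end_meets (R : realType) (Omega U : set R) :
  Omega !=set0 -> open Omega -> sup_end Omega U -> exists2 w, Omega w & U w.
Proof.
move=> [w0 Ow0] oO; rewrite /sup_end.
case E : (ereal_sup (EFin @` Omega)) => [r| |].
- case=> e /= e0 eU.
  have [_ [w Ow <-] wre] : exists2 x, (EFin @` Omega) x & ((r - e)%:E < x)%E.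
    by apply: ereal_sup_gt; rewrite E lte_fin gtrDl oppr_lt0.
  have rw (x : R) : Omega x -> x <= r.
    by move=> Ox; rewrite -lee_fin -E; apply: ereal_sup_ubound; exists x.
  have nr : ~ Omega r.
    move=> Or; have /nbhs_ballP[d /= d0 dO] : nbhs r Omega by exact: open_nbhs_nbhs.
    have /rw : Omega (r + d / 2).
      apply: dO; rewrite /ball/= opprD addrA subrr add0r normrN.
      rewrite ger0_norm ?divr_ge0 ?ltW//.
      by rewrite ltr_pdivrMr// ltr_pMr// ltr1n.
    by rewrite leNgt ltrDl divr_gt0.
  have rltw : w < r.
    by rewrite lt_neqAle rw// andbT; apply/eqP => rE; apply: nr; rewrite -rE.
  exists w => //; apply: eU => //=.
  by rewrite gtr0_norm ?subr_gt0// ltrBlDr -ltrBlDl -lte_fin.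
- case=> M [_ MU].
  have [_ [w Ow <-] wM] : exists2 x, (EFin @` Omega) x & (M%:E < x)%E.
    by apply: ereal_sup_gt; rewrite E ltry.
  by exists w => //; apply: MU; rewrite -lte_fin.
- exfalso; have : (w0%:E <= ereal_sup (EFin @` Omega))%E.
    by apply: ereal_sup_ubound; exists w0.
  by rewrite E.
Qed.

Lemma derivable1_continuous (R : realType) (f : R -> R) (x : R) :
  derivable f x 1 -> {for x, continuous f}.
Proof. by move=> ?; exact/differentiable_continuous/derivable1_diffP. Qed.

(** Surjectivity is the intermediate value theorem between a point of [Omega]
    close to its lower end and a point close to its upper end. *)
Lemma admissible_ray_param (R : realType) (Omega : set R) (psi : R -> R) :
  admissible Omega psi -> ray_param Omega psi.
Proof.
move=> adm; split.
- exact: (adm_open adm).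
- exact: (adm_interval adm).
- exact: (adm_gt0 adm).
- exact: (adm_derivable adm).
- move=> w Ow; have := adm_C1 adm.
  rewrite continuous_open_subspace; last exact: (adm_open adm).
  by apply; rewrite inE.
- by move=> x y; rewrite !inE; exact: (adm_incr adm).
move=> y y0.
have [w1 Ow1 w1y] : exists2 w, Omega w & psi w < y.
  apply: inf_end_meets; [exact: (adm_nonempty adm)|exact: (adm_open adm)|].
  have /(_ [set u | u < y]) := adm_inf adm; apply.
  exact: lt_nbhsl.
have [w2 Ow2 w2y] : exists2 w, Omega w & y < psi w.
  apply: sup_end_meets; [exact: (adm_nonempty adm)|exact: (adm_open adm)|].
  have /(_ [set u | y < u]) := adm_sup adm; apply.
  by exists y; split; [exact: num_real|].
have w12 : w1 <= w2.
  rewrite leNgt; apply/negP => /(adm_incr adm Ow2 Ow1) w21.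
  by have := lt_trans (lt_trans w1y w2y) w21; rewrite ltxx.
have Ow x : x \in `[w1, w2] -> Omega x.
  rewrite in_itv/= => /andP[w1x xw2].
  by apply: (adm_interval adm Ow1 Ow2); apply/andP.
have [] := @IVT _ psi w1 w2 y w12.
- apply: derivable_within_continuous => x /Ow; exact: (adm_derivable adm).
- have pp : psi w1 <= psi w2 by apply/ltW/(lt_trans w1y).
  by rewrite (min_idPl pp) (max_idPr pp) !ltW.
by move=> w /Ow ? <-; exists w.
Qed.

Lemma ray_derive_ge0 (R : realType) (Omega : set R) (psi : R -> R) (w : R) :
  ray_param Omega psi -> Omega w -> 0 <= psi^`()%classic w.
Proof.
move=> r Ow; apply: (@incr_derive1_ge0 R psi Omega).
- move=> x; rewrite (interior_id _).1 ?inE; last exact: (ray_open r).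
  exact: (ray_derivable r).
- exact: (ray_incr r).
- by rewrite (interior_id _).1//; exact: (ray_open r).
Qed.

Lemma ray_continuous (R : realType) (Omega : set R) (psi : R -> R) (w : R) :
  ray_param Omega psi -> Omega w -> {for w, continuous psi}.
Proof. by move=> r Ow; apply/derivable1_continuous/(ray_derivable r). Qed.

Lemma ray_measurable (R : realType) (Omega : set R) (psi : R -> R) :
  ray_param Omega psi -> measurable Omega.
Proof. by move=> r; apply: open_measurable; exact: (ray_open r). Qed.

Lemma ray_mono (R : realType) (Omega : set R) (psi : R -> R) (x y : R) :
  ray_param Omega psi -> Omega x -> Omega y -> (psi x <= psi y) = (x <= y).
Proof.
move=> r Ox Oy; apply/idP/idP; last first.
  rewrite le_eqVlt => /predU1P[->//|xy]; apply/ltW.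
  by apply: (ray_incr r) => //; rewrite inE.
by apply: contraTT; rewrite -!ltNge => yx; apply: (ray_incr r) => //; rewrite inE.
Qed.

Lemma inv_bounds (R : realType) (y : R) : 0 < y ->
  exists2 n : nat, n.+1%:R^-1 <= y & y <= n.+1%:R.
Proof.
move=> y0; pose m := Num.max y y^-1.
have m0 : 0 <= m by rewrite le_max ltW.
have mn : m <= (Num.truncn m).+1%:R by rewrite ltW// truncnS_gt.
exists (Num.truncn m); last by apply: le_trans mn; rewrite le_max lexx.
rewrite -[leRHS]invrK lef_pV2 ?posrE ?invr_gt0//.
by apply: le_trans mn; rewrite le_max lexx orbT.
Qed.

(** On the compact intervals [psi^-1 [1/(n+1), n+1]] this is the usual
    substitution rule, since [psi'] extends continuously to their endpoints;
    these intervals increase to [Omega] and their images to [(0, +oo)], and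
    monotone convergence concludes because both integrands are nonnegative. *)
Lemma ray_change_of_variables (R : realType) (Omega : set R) (psi G : R -> R) :
  ray_param Omega psi ->
  (forall u : R, 0 < u -> {for u, continuous G}) -> (forall u : R, 0 < u -> 0 <= G u) ->
  (\int[mu]_(w in Omega) (G (psi w) * psi^`()%classic w)%:E =
   \int[mu]_(u in `]0%R, +oo[) (G u)%:E)%E.
Proof.
move=> r cG G0.
have [p Op pE] : exists2 p : nat -> R, (forall n, Omega (p n)) &
    forall n, psi (p n) = n.+1%:R^-1.
  have H n : exists w, Omega w /\ psi w = n.+1%:R^-1.
    by have [|w ? ?] := ray_surj r (y := n.+1%:R^-1); [|exists w].
  by have [p Hp] := choice H; exists p => n; case: (Hp n).
have [q Oq qE] : exists2 q : nat -> R, (forall n, Omega (q n)) &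
    forall n, psi (q n) = n.+1%:R.
  have H n : exists w, Omega w /\ psi w = n.+1%:R.
    by have [|w ? ?] := ray_surj r (y := n.+1%:R); [|exists w].
  by have [q Hq] := choice H; exists q => n; case: (Hq n).
have pq n : p n <= q n.
  by rewrite -(ray_mono r)// pE qE; apply: (@le_trans _ _ 1);
    rewrite ?invf_le1 ?ler1n ?ltr0n.
have pqO n x : x \in `[p n, q n] -> Omega x.
  rewrite in_itv/= => xpq; by apply: (ray_interval r (Op n) (Oq n)).
pose E n : set R := `[p n, q n]%classic.
pose F n : set R := `[n.+1%:R^-1, n.+1%:R]%classic.
have UE : \bigcup_n E n = Omega.
  apply/seteqP; split => [x [n _]|w Ow]; first exact: pqO.
  have [n pn qn] := inv_bounds (ray_gt0 r Ow).
  exists n; first by [].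
  by rewrite /E/= in_itv/= -(ray_mono r (Op n) Ow) -(ray_mono r Ow (Oq n)) pE qE pn.
have UF : \bigcup_n F n = `]0, +oo[%classic.
  apply/seteqP; split => [x [n _]|u]; rewrite /F/= !in_itv/= andbT.
    by move=> /andP[+ _]; apply: lt_le_trans.
  move=> /inv_bounds[n nu un]; exists n; first by [].
  by rewrite /F/= in_itv/= nu.
have mG : measurable_fun (`]0, +oo[%classic : set R) G.
  apply: open_continuous_measurable_fun; first exact: interval_open.
  by move=> x; rewrite inE/= in_itv/= andbT => /cG.
have mGpsi : measurable_fun Omega (fun w => G (psi w) * psi^`()%classic w).
  apply: open_continuous_measurable_fun; first exact: (ray_open r).
  move=> x; rewrite inE => Ox.
  apply: continuousM; last exact: (ray_C1 r).
  apply: continuous_comp; first exact: (ray_continuous r Ox).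
  by apply: cG; exact: (ray_gt0 r).
have cvE : (\int[mu]_(w in E n) (G (psi w) * psi^`()%classic w)%:E)%E @[n --> \oo]
    --> (\int[mu]_(w in Omega) (G (psi w) * psi^`()%classic w)%:E)%E.
  rewrite -UE; apply: ge0_nondecreasing_set_cvg_integral.
  - move=> m n mn; rewrite subsetEset /E; move=> x /=.
    rewrite !in_itv/= => /andP[px xq]; apply/andP; split.
      apply: le_trans px; rewrite -(ray_mono r (Op n) (Op m)) !pE.
      by rewrite lef_pV2 ?posrE// ler_nat ltnS.
    by apply: (le_trans xq); rewrite -(ray_mono r (Oq m) (Oq n)) !qE ler_nat ltnS.
  - by move=> n; exact: measurable_itv.
  - move=> n; apply/measurable_EFinP; apply: measurable_funS mGpsi.
      exact: (ray_measurable r).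
    exact: pqO.
  - move=> n x /pqO Ox; rewrite lee_fin mulr_ge0//.
      by apply/G0/(ray_gt0 r).
    exact: (ray_derive_ge0 r Ox).
have cvF : (\int[mu]_(w in E n) (G (psi w) * psi^`()%classic w)%:E)%E @[n --> \oo]
    --> (\int[mu]_(u in `]0%R, +oo[) (G u)%:E)%E.
  rewrite (_ : (fun n => _) = (fun n => \int[mu]_(u in F n) (G u)%:E)%E); last first.
    apply/funext => n; rewrite /F -(pE n) -(qE n).
    rewrite (@integration_by_substitution_increasing _ psi)//.
    - by move=> x y /pqO Ox /pqO Oy; apply: (ray_incr r); rewrite inE.
    - move=> x xpq; apply: (ray_C1 r); apply: (pqO n).
      exact: subset_itv_oo_cc xpq.
    - apply/cvg_ex; exists (psi^`()%classic (p n)).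
      by apply: cvg_at_right_filter; exact: (ray_C1 r).
    - apply/cvg_ex; exists (psi^`()%classic (q n)).
      by apply: cvg_at_left_filter; exact: (ray_C1 r).
    - split.
      + move=> x xpq; apply: (ray_derivable r); apply: (pqO n).
        exact: subset_itv_oo_cc xpq.
      + by apply: cvg_at_right_filter; exact: (ray_continuous r).
      + by apply: cvg_at_left_filter; exact: (ray_continuous r).
    - apply: continuous_in_subspaceT => x; rewrite inE/= in_itv/= => /andP[px _].
      by apply: cG; apply: lt_le_trans px; exact: (ray_gt0 r).
  rewrite -UF; apply: ge0_nondecreasing_set_cvg_integral.
  - move=> m n mn; rewrite subsetEset /F; move=> x /=.
    rewrite !in_itv/= => /andP[px xq]; apply/andP; split.
      by apply: le_trans px; rewrite lef_pV2 ?posrE// ler_nat ltnS.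
    by apply: (le_trans xq); rewrite ler_nat ltnS.
  - by move=> n; exact: measurable_itv.
  - move=> n; apply/measurable_EFinP; apply: measurable_funS mG => //.
    rewrite -UF; exact: bigcup_sup.
  - move=> n x; rewrite /F/= in_itv/= => /andP[nx _]; rewrite lee_fin.
    by apply: G0; apply: lt_le_trans nx.
exact: cvg_unique cvE cvF.
Qed.

(** * Exchanging integrals on rectangles *)

(** Reduces integrals over a rectangle to integrals over the plane, where the
    theorems of Tonelli and Fubini are stated. *)
Lemma iterated_integral_rect (R : realType) (D E : set R) (k : R * R -> \bar R) :
  (\int[mu]_(x in D) \int[mu]_(y in E) k (x, y) =
   \int[mu]_x \int[mu]_y (k \_ (D `*` E)) (x, y))%E /\
  (\int[mu]_(y in E) \int[mu]_(x in D) k (x, y) =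
   \int[mu]_y \int[mu]_x (k \_ (D `*` E)) (x, y))%E.
Proof.
split; rewrite integral_mkcond; apply: eq_integral => x _; rewrite patchE.
- have [|xD] := asboolP (x \in D).
    rewrite inE => xD; rewrite mem_set//= integral_mkcond.
    apply: eq_integral => y _; rewrite !patchE.
    rewrite (_ : ((x, y) \in D `*` E) = (y \in E))//.
    by apply/idP/idP; rewrite !inE => //= -[].
  rewrite (negbTE (introN idP xD)) integral0_eq// => y _; rewrite patchE ifF//.
  by apply/negbTE/negP; rewrite inE => -[/= + _]; rewrite -inE.
- have [|xD] := asboolP (x \in E).
    rewrite inE => xE; rewrite mem_set//= integral_mkcond.
    apply: eq_integral => y _; rewrite !patchE.
    rewrite (_ : ((y, x) \in D `*` E) = (y \in D))//.
    by apply/idP/idP; rewrite !inE => //= -[].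
  rewrite (negbTE (introN idP xD)) integral0_eq// => y _; rewrite patchE ifF//.
  by apply/negbTE/negP; rewrite inE => -[/= _ +]; rewrite -inE.
Qed.

Lemma tonelli_rect (R : realType) (D E : set R) (k : R * R -> \bar R) :
  measurable D -> measurable E -> measurable_fun (D `*` E) k ->
  (forall x y, D x -> E y -> 0 <= k (x, y))%E ->
  (\int[mu]_(x in D) \int[mu]_(y in E) k (x, y) =
   \int[mu]_(y in E) \int[mu]_(x in D) k (x, y))%E.
Proof.
move=> mD mE mk k0; have [-> ->] := iterated_integral_rect D E k.
apply: fubini_tonelli.
  by apply/(measurable_restrict _ _ _).1 => //; [exact: measurableX|rewrite setTI].
by move=> [x y]; rewrite patchE; case: ifPn => //; rewrite inE => -[/k0]; apply.
Qed.

Lemma fubini_rect (R : realType) (D E : set R) (k : R * R -> \bar R) :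
  measurable D -> measurable E -> measurable_fun (D `*` E) k ->
  (\int[mu]_(x in D) \int[mu]_(y in E) `|k (x, y)| < +oo)%E ->
  (\int[mu]_(x in D) \int[mu]_(y in E) k (x, y) =
   \int[mu]_(y in E) \int[mu]_(x in D) k (x, y))%E.
Proof.
move=> mD mE mk kfin; have [-> ->] := iterated_integral_rect D E k.
have mk' : measurable_fun setT (k \_ (D `*` E)).
  by apply/(measurable_restrict _ _ _).1 => //; [exact: measurableX|rewrite setTI].
apply: Fubini; apply/integrable12ltyP => //.
have [+ _] := iterated_integral_rect D E (fun z => `|k z|)%E.
rewrite /= => kE; move: kfin; rewrite kE; congr (_ < _)%E.
apply: eq_integral => x _; apply: eq_integral => y _.
by rewrite !patchE; case: ifPn => //; rewrite abse0.
Qed.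

(** All the double integrals of the proof, those about Gamma and the one of the
    theorem, have an integrand of this shape. *)
Lemma measurable_laplace_kernel (R : realType) (D E : set R) (p q X Y : R -> R) :
  measurable D -> measurable E ->
  measurable_fun D p -> measurable_fun E q ->
  measurable_fun D X -> measurable_fun E Y ->
  measurable_fun (D `*` E)
    (fun z : R * R => (p z.1 * q z.2 * expR (- (X z.1 * Y z.2)))%:E).
Proof.
move=> mD mE mp mq mX mY; apply/measurable_EFinP.
have m1 : forall h : R -> R, measurable_fun D h ->
    measurable_fun (D `*` E) (fun z : R * R => h z.1).
  move=> h mh; apply: (measurable_comp mD _ mh) => //.
    by move=> _ [z [/= ? _] <-].
  exact: measurable_funTS measurable_fst.
have m2 : forall h : R -> R, measurable_fun E h ->
    measurable_fun (D `*` E) (fun z : R * R => h z.2).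
  move=> h mh; apply: (measurable_comp mE _ mh) => //.
    by move=> _ [z [/= _ ?] <-].
  exact: measurable_funTS measurable_snd.
apply: measurable_funM; first by apply: measurable_funM; [exact: m1|exact: m2].
apply: measurableT_comp => //; apply: measurableT_comp => //.
by apply: measurable_funM; [exact: m1|exact: m2].
Qed.

(** * Elementary improper integrals *)

Lemma continuous_powR (R : realType) (p u : R) :
  0 < u -> {for u, continuous (fun v : R => v `^ p)}.
Proof.
by move=> u0; apply/derivable1_continuous/derivable_powR; rewrite in_itv/= u0.
Qed.

Lemma continuous_expRNM (R : realType) (s u : R) :
  {for u, continuous (fun v : R => expR (- (s * v)))}.
Proof.
apply: continuous_comp; last exact: continuous_expR.
by apply: continuousN; apply: continuousM; [exact: cst_continuous|exact: cvg_id].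
Qed.

Lemma cvg_powRNy (R : realType) (x : R) : 0 < x -> s `^ (- x) @[s --> +oo] --> 0.
Proof.
move=> x0; apply/cvgrPdist_lt => e e0.
have m0 : 0 < (e^-1) `^ x^-1 by rewrite powR_gt0// invr_gt0.
near=> s; have ms : (e^-1) `^ x^-1 < s.
  by near: s; apply: nbhs_pinfty_gt; rewrite num_real.
have s0 : 0 < s by apply: lt_trans ms.
rewrite sub0r normrN ger0_norm ?powR_ge0// powRN.
rewrite -[ltRHS]invrK ltf_pV2 ?posrE ?invr_gt0// ?powR_gt0//.
have -> : e^-1 = ((e^-1) `^ x^-1) `^ x.
  by rewrite -powRrM mulVf ?gt_eqF// powRr1// invr_ge0 ltW.
by apply: gt0_ltr_powR => //; rewrite nnegrE ltW.
Unshelve. all: end_near. Qed.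

Lemma integral1y_powRN (R : realType) (x : R) : 0 < x ->
  (\int[mu]_(s in `[1%R, +oo[) (s `^ (- (x + 1)))%:E = (x^-1)%:E)%E.
Proof.
move=> x0; have xn0 : - x != 0 by rewrite oppr_eq0 gt_eqF.
pose F (s : R) : R := - x^-1 * s `^ (- x).
have dF (s : R) : 0 < s -> is_derive s 1 F (s `^ (- (x + 1))).
  move=> s0; have := @is_derive1_powR R (- x) s s0 => H.
  rewrite (_ : s `^ (- (x + 1)) = - x^-1 * (- x * s `^ (- x - 1))).
    rewrite /F; exact: is_deriveZ.
  by rewrite mulrA mulrNN mulVf ?gt_eqF// mul1r opprD.
rewrite (@ge0_continuous_FTC2y _ _ F _ 0).
- by rewrite /F powR1 mulr1 sub0e EFinN oppeK.
- by move=> s _; exact: powR_ge0.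
- apply: continuous_in_subspaceT => s; rewrite inE/= in_itv/= andbT => s1.
  by apply: continuous_powR; exact: lt_le_trans s1.
- rewrite /F -[X in _ --> X](mulr0 (- x^-1)); apply: cvgM; first exact: cvg_cst.
  exact: cvg_powRNy.
- by move=> s s1; have [] := dF s (lt_trans ltr01 s1).
- apply: cvg_at_right_filter; apply: derivable1_continuous.
  by have [] := dF 1 ltr01.
- move=> s; rewrite in_itv/= andbT => s1.
  by rewrite derive1E; have [_ ->] := dF s (lt_trans ltr01 s1).
Qed.

Lemma integraly_expRN (R : realType) (c a : R) : 0 < c ->
  (\int[mu]_(s in `[a, +oo[) (expR (- (c * s)))%:E = (expR (- (c * a)) / c)%:E)%E.
Proof.
move=> c0; pose F (s : R) : R := - c^-1 * expR (- (c * s)).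
have dF (s : R) : is_derive s 1 F (expR (- (c * s))).
  apply: is_derive_eq.
  by rewrite /GRing.scale/=; field; rewrite gt_eqF.
rewrite (@ge0_continuous_FTC2y _ _ F _ 0).
- by rewrite /F sub0e mulNr EFinN oppeK mulrC.
- by move=> s _; exact: expR_ge0.
- by apply: continuous_in_subspaceT => s _; exact: continuous_expRNM.
- rewrite /F -[X in _ --> X](mulr0 (- c^-1)); apply: cvgM; first exact: cvg_cst.
  apply: (@cvg_comp _ _ _ (fun s => c * s) (fun y => expR (- y))); last exact: cvgr_expR.
  exact: gt0_cvgMry.
- by move=> s s1; have [] := dF s.
- apply: cvg_at_right_filter; apply: derivable1_continuous.
  by have [] := dF a.
- by move=> s _; rewrite derive1E; have [_ ->] := dF s.
Qed.

(** * The Gamma integral and Laplace transforms of powers *)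

Lemma measurable_expRNM (R : realType) (D : set R) (c : R) :
  measurable_fun D (fun s : R => expR (- (c * s))).
Proof.
apply: measurable_funTS; apply: continuous_measurable_fun => s.
exact: continuous_expRNM.
Qed.

Lemma measurable_powR_expRN (R : realType) (D : set R) (p c : R) :
  measurable_fun D (fun u : R => (u `^ p * expR (- (c * u)))%:E).
Proof.
apply/measurable_EFinP; apply: measurable_funTS; apply: measurable_funM.
  exact: measurable_powR.
exact: measurable_expRNM.
Qed.

Lemma derive_scale (R : realType) (s : R) :
  (fun u : R => s * u)^`()%classic = cst s.
Proof.
apply/funext => w; rewrite derive1E.
have dE : is_derive w 1 (fun u : R => s * u) s.
  by apply: is_derive_eq; rewrite /GRing.scale/= mulr1.
by have [_ ->] := dE.
Qed.

Lemma ray_param_scale (R : realType) (s : R) : 0 < s ->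
  ray_param `]0, +oo[%classic (fun u : R => s * u).
Proof.
move=> s0; split.
- exact: interval_open.
- exact: interval_is_interval.
- by move=> w /=; rewrite in_itv/= andbT => w0; exact: mulr_gt0.
- by move=> w _; exact: derivableM.
- by move=> w _; rewrite derive_scale; exact: cvg_cst.
- by move=> x y _ _ xy; rewrite ltr_pM2l.
- move=> y y0; exists (y / s); first by rewrite /= in_itv/= andbT divr_gt0.
  by rewrite mulrC divfK// gt_eqF.
Qed.

Lemma derive_powR (R : realType) (p u : R) : 0 < u ->
  (fun v : R => v `^ p)^`()%classic u = p * u `^ (p - 1).
Proof. by move=> u0; rewrite powR_derive1// in_itv/= u0. Qed.

Lemma ray_param_powR (R : realType) (p : R) : 0 < p ->
  ray_param `]0, +oo[%classic (fun u : R => u `^ p).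
Proof.
move=> p0; split.
- exact: interval_open.
- exact: interval_is_interval.
- by move=> w /=; rewrite in_itv/= andbT => w0; exact: powR_gt0.
- move=> w /=; rewrite in_itv/= andbT => w0.
  by apply: derivable_powR; rewrite in_itv/= w0.
- move=> w /=; rewrite in_itv/= andbT => w0.
  have pE : \forall u \near w, p * u `^ (p - 1) = (fun v : R => v `^ p)^`()%classic u.
    by near=> u; rewrite derive_powR//; near: u; exact: lt_nbhsr.
  rewrite /prop_for /continuous_at derive_powR//; apply: cvg_trans (near_eq_cvg pE) _.
  by apply: cvgM; [exact: cvg_cst|exact: continuous_powR].
- move=> x y; rewrite !inE/= !in_itv/= !andbT => x0 y0 xy.
  by apply: gt0_ltr_powR => //; rewrite nnegrE ltW.
- move=> y y0; exists (y `^ p^-1); first by rewrite /= in_itv/= andbT powR_gt0.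
  by rewrite -powRrM mulVf ?gt_eqF// powRr1// ltW.
Unshelve. all: end_near. Qed.

(** Euler's integral with its value in the extended reals, so that Tonelli's
    theorem applies before convergence is known. *)
Definition eGamma (R : realType) (x : R) : \bar R :=
  (\int[mu]_(s in `]0%R, +oo[) (s `^ (x - 1) * expR (- s))%:E)%E.

Lemma eGamma_ge0 (R : realType) (x : R) : (0 <= eGamma x)%E.
Proof.
by apply: integral_ge0 => s _; rewrite lee_fin mulr_ge0 ?powR_ge0 ?expR_ge0.
Qed.

(** Substitute [v = s u] in Euler's integral. *)
Lemma laplace_powR (R : realType) (x s : R) : 0 < s ->
  (\int[mu]_(u in `]0%R, +oo[) (u `^ (x - 1) * expR (- (s * u)))%:E =
   (s `^ (- x))%:E * eGamma x)%E.
Proof.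
move=> s0; pose G (v : R) := v `^ (x - 1) * expR (- v).
have cG (v : R) : 0 < v -> {for v, continuous G}.
  move=> v0; apply: cvgM; first exact: continuous_powR.
  apply: continuous_comp; last exact: continuous_expR.
  by apply: continuousN; exact: cvg_id.
have G0 (v : R) : 0 < v -> 0 <= G v by rewrite mulr_ge0 ?powR_ge0 ?expR_ge0.
have -> : eGamma x = (\int[mu]_(u in `]0%R, +oo[)
    ((s `^ x)%:E * (u `^ (x - 1) * expR (- (s * u)))%:E))%E.
  rewrite /eGamma -(ray_change_of_variables (ray_param_scale s0) cG G0).
  apply: eq_integral => u; rewrite inE/= in_itv/= andbT => u0.
  rewrite -EFinM; congr EFin; rewrite derive_scale /G/=.
  rewrite powRM ?ltW//; have -> : s `^ x = s `^ (x - 1) * s.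
    by rewrite -[X in _ * X]powRr1 ?ltW// -powRD ?subrK// (gt_eqF s0) implybT.
  by ring.
rewrite ge0_integralZl//=.
- by rewrite muleA -EFinM -powRD ?addNr ?powRr0 ?mul1e// (gt_eqF s0) implybT.
- exact: measurable_powR_expRN.
- by move=> u _; rewrite lee_fin mulr_ge0 ?powR_ge0 ?expR_ge0.
- by rewrite lee_fin powR_ge0.
Qed.

(** The integral over [Omega] does not see [psi]: this is why every admissible
    transformation gives the same value. *)
Lemma ray_laplace_powR (R : realType) (Omega : set R) (psi : R -> R) (x s : R) :
  ray_param Omega psi -> 0 < s ->
  (\int[mu]_(w in Omega)
     (psi w `^ (x - 1) * expR (- (s * psi w)) * psi^`()%classic w)%:E =
   (s `^ (- x))%:E * eGamma x)%E.
Proof.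
move=> r s0; rewrite -laplace_powR//.
pose G (v : R) := v `^ (x - 1) * expR (- (s * v)).
rewrite -(ray_change_of_variables (G := G) r)//.
- move=> v v0; apply: cvgM; [exact: continuous_powR|exact: continuous_expRNM].
- by move=> v v0; rewrite mulr_ge0 ?powR_ge0 ?expR_ge0.
Qed.

(** Integrate [int_0^oo u^x exp(-s u) du = s^-(x+1) Gamma(x+1)] over
    [s >= 1]. The right side gives [Gamma(x+1) / x]; on the left,
    [int_1^oo exp(-s u) ds = exp(-u) / u] turns the integral into [Gamma(x)]. *)
Lemma eGamma_rec (R : realType) (x : R) : 0 < x ->
  eGamma (x + 1) = (x%:E * eGamma x)%E.
Proof.
move=> x0; have m0 (D : set R) : measurable_fun D (fun u : R => u `^ x).
  by apply: measurable_funTS; exact: measurable_powR.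
have := @tonelli_rect R `[1, +oo[%classic `]0, +oo[%classic
  (fun z => (1 * z.2 `^ x * expR (- (z.1 * z.2)))%:E).
rewrite /= => /(_ _ _ _ _)/=; rewrite (_ : (\int[mu]_(s in _) _)%E =
   (x^-1%:E * eGamma (x + 1))%E) /=; last first.
  rewrite -integral1y_powRN// -ge0_integralZr//=.
  - apply: eq_integral => s; rewrite inE/= in_itv/= andbT => s1.
    rewrite -laplace_powR ?(lt_le_trans ltr01)//.
    by apply: eq_integral => u _; rewrite mul1r addrK.
  - by apply/measurable_EFinP; apply: measurable_funTS; exact: measurable_powR.
  - by move=> s _; rewrite lee_fin powR_ge0.
  - exact: eGamma_ge0.
rewrite (_ : (\int[mu]_(s in `]0%R, +oo[) _)%E = eGamma x); last first.
  apply: eq_integral => u; rewrite inE/= in_itv/= andbT => u0.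
  transitivity (\int[mu]_(s in `[1%R, +oo[)
      ((u `^ x)%:E * (expR (- (u * s)))%:E))%E.
    by apply: eq_integral => s _; rewrite mul1r EFinM mulrC.
  rewrite ge0_integralZl//=.
  - rewrite integraly_expRN// -EFinM mulr1; congr EFin.
    rewrite mulrCA mulrC; congr (_ * _).
    by rewrite powRD ?powR_inv1 ?ltW// (gt_eqF u0) implybT.
  - apply/measurable_EFinP; apply: measurable_funTS.
    by apply: measurableT_comp => //; apply: measurableT_comp.
  - by rewrite lee_fin powR_ge0.
move=> H; rewrite -H.
- by rewrite muleA -EFinM mulfV ?gt_eqF// mul1e.
- exact: measurable_itv.
- exact: measurable_itv.
- apply: (@measurable_laplace_kernel _ _ _ (cst 1) (fun u => u `^ x) id id) => //.
- by move=> s u _ _; rewrite lee_fin mul1r mulr_ge0 ?powR_ge0 ?expR_ge0.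
Qed.

(** * The beta integral on the half-line *)

(** Here [f] may blow up at the endpoints, as long as its primitive [F] does
    not: monotone convergence along segments exhausting the open interval. *)
Lemma ge0_FTC2_oo (R : realType) (f F : R -> R) (a b : R) : a < b ->
  (forall x, x \in `]a, b[ -> 0 <= f x) ->
  {in `]a, b[, continuous f} ->
  derivable_oo_LRcontinuous F a b ->
  {in `]a, b[, F^`()%classic =1 f} ->
  (\int[mu]_(x in `]a, b[) (f x)%:E = (F b - F a)%:E)%E.
Proof.
move=> ab f0 cf [dF Fa Fb] F'f.
have ba0 : 0 < b - a by rewrite subr_gt0.
pose d (n : nat) : R := (b - a) * n.+3%:R^-1.
have d0 n : 0 < d n by rewrite mulr_gt0// invr_gt0.
have d2 n : d n + d n < b - a.
  rewrite -mulrDr -[ltRHS]mulr1 ltr_pM2l// -mulr2n -(mulr_natl _ 2).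
  by rewrite ltr_pdivrMr// mul1r ltr_nat.
have dd m n : (m <= n)%N -> d n <= d m.
  by move=> mn; rewrite ler_pM2l// lef_pV2 ?posrE// ler_nat !ltnS.
have cd : d n @[n --> \oo] --> 0.
  rewrite -[X in _ --> X](mulr0 (b - a)); apply: cvgM; first exact: cvg_cst.
  have := @cvg_harmonic R; rewrite -(cvg_shiftn 2); apply: cvg_trans.
  by apply: near_eq_cvg; near=> n; rewrite /harmonic/= addn2.
pose E n : set R := `[a + d n, b - d n]%classic.
have Esub n x : x \in `[a + d n, b - d n] -> x \in `]a, b[.
  rewrite !in_itv/= => /andP[ax xb]; apply/andP; split.
    by apply: lt_le_trans ax; rewrite ltrDl.
  by apply: (le_lt_trans xb); rewrite gtrDl oppr_lt0.
have UE : \bigcup_n E n = `]a, b[%classic.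
  apply/seteqP; split => [x [n _]|x]; first exact: Esub.
  rewrite /= in_itv/= => /andP[ax xb].
  pose e := Num.min (x - a) (b - x).
  have e0 : 0 < e by rewrite lt_min !subr_gt0 ax.
  have : \forall n \near \oo, d n < e by exact: cvgr_lt cd e e0.
  case=> n _ /(_ n (leqnn n))/=; rewrite lt_min => /andP[dx db].
  exists n; first by [].
  by rewrite /E/= in_itv/= -lerBrDl ltW//= lerBrDr -lerBrDl ltW.
have mf : measurable_fun (`]a, b[%classic : set R) f.
  apply: open_continuous_measurable_fun; first exact: interval_open.
  by move=> x; rewrite inE/= => /cf.
have cv1 : (\int[mu]_(x in E n) (f x)%:E)%E @[n --> \oo]
    --> (\int[mu]_(x in `]a, b[) (f x)%:E)%E.
  rewrite -UE; apply: ge0_nondecreasing_set_cvg_integral.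
  - move=> m n mn; rewrite subsetEset => x; rewrite /E/= !in_itv/= => /andP[ax xb].
    apply/andP; split; first by apply: le_trans ax; rewrite lerD2l dd.
    by apply: (le_trans xb); rewrite lerD2l lerN2 dd.
  - by move=> n; exact: measurable_itv.
  - by move=> n; apply/measurable_EFinP; apply: measurable_funS mf => //; exact: Esub.
  - by move=> n x /Esub xab; rewrite lee_fin f0.
have cv2 : (\int[mu]_(x in E n) (f x)%:E)%E @[n --> \oo] --> (F b - F a)%:E.
  rewrite (_ : (fun n => _) = fun n => (F (b - d n) - F (a + d n))%:E).
    apply: cvg_EFin; first by near=> n.
    apply: cvgB.
      have [+ _] := cvg_at_leftP F b (F b); move=> /(_ Fb); apply; split.
        by move=> n; rewrite gtrDl oppr_lt0.
      by rewrite -[X in _ --> X]subr0; apply: cvgB cd; exact: cvg_cst.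
    have [+ _] := cvg_at_rightP F a (F a); move=> /(_ Fa); apply; split.
      by move=> n; rewrite ltrDl.
    by rewrite -[X in _ --> X]addr0; apply: cvgD cd; exact: cvg_cst.
  apply/funext => n; rewrite (@continuous_FTC2 _ f F).
  - by rewrite EFinB.
  - by rewrite ltrBrDr -addrA -ltrBrDl.
  - by apply: continuous_in_subspaceT => x; rewrite inE => /Esub /cf.
  - have aE : a + d n \in `]a, b[.
      by apply: (Esub n); rewrite in_itv/= lexx lerBrDr -addrA -lerBrDl ltW.
    have bE : b - d n \in `]a, b[.
      by apply: (Esub n); rewrite in_itv/= lexx andbT lerBrDr -addrA -lerBrDl ltW.
    split.
    + by move=> x /subset_itv_oo_cc /Esub; exact: dF.
    + by apply: cvg_at_right_filter; apply/derivable1_continuous/dF.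
    + by apply: cvg_at_left_filter; apply/derivable1_continuous/dF.
  - by move=> x /subset_itv_oo_cc /Esub; exact: F'f.
exact: cvg_unique cv1 cv2.
Unshelve. all: end_near. Qed.

Definition beta_ker (R : realType) (x u : R) : R := u `^ (x - 1) / (1 + u).

Lemma beta_ker_ge0 (R : realType) (x u : R) : 0 < u -> 0 <= beta_ker x u.
Proof. by move=> u0; rewrite /beta_ker divr_ge0 ?powR_ge0// addr_ge0// ltW. Qed.

Lemma continuous_beta_ker (R : realType) (x u : R) :
  0 < u -> {for u, continuous (beta_ker x)}.
Proof.
move=> u0; apply: cvgM; first exact: continuous_powR.
apply: cvgV; first by rewrite gt_eqF// addr_gt0.
by apply: cvgD; [exact: cvg_cst|exact: cvg_id].
Qed.

Lemma measurable_beta_ker (R : realType) (x : R) :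
  measurable_fun (`]0, +oo[%classic : set R) (beta_ker x).
Proof.
apply: open_continuous_measurable_fun; first exact: interval_open.
by move=> u; rewrite inE/= in_itv/= andbT => u0; exact: continuous_beta_ker.
Qed.

(** Integrate [exp(-s) u^(x-1) exp(-s u)] over the quadrant in both orders. *)
Lemma eGamma_reflected (R : realType) (x : R) :
  (eGamma x * eGamma (1 - x) =
   \int[mu]_(u in `]0%R, +oo[) (beta_ker x u)%:E)%E.
Proof.
have mE : measurable_fun setT (fun s : R => expR (- s)).
  by apply: measurableT_comp.
have := @tonelli_rect R `]0, +oo[%classic `]0, +oo[%classic
  (fun z => (expR (- z.1) * z.2 `^ (x - 1) * expR (- (z.1 * z.2)))%:E).
rewrite /= => /(_ _ _ _ _)/= H.
transitivity (\int[mu]_(s in `]0%R, +oo[) \int[mu]_(u in `]0%R, +oo[)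
    (expR (- s) * u `^ (x - 1) * expR (- (s * u)))%:E)%E.
  rewrite muleC; transitivity (\int[mu]_(s in `]0%R, +oo[)
      ((s `^ (1 - x - 1) * expR (- s))%:E * eGamma x))%E.
    have mG : measurable_fun (`]0, +oo[%classic : set R)
        (fun s : R => (s `^ (1 - x - 1) * expR (- s))%:E).
      apply/measurable_EFinP; apply: measurable_funM; last exact: measurable_funTS.
      by apply: measurable_funTS; exact: measurable_powR.
    rewrite ge0_integralZr; [by []|exact: measurable_itv|exact: mG| |exact: eGamma_ge0].
    by move=> s _; rewrite lee_fin mulr_ge0 ?powR_ge0 ?expR_ge0.
  apply: eq_integral => s; rewrite inE/= in_itv/= andbT => s0.
  transitivity (\int[mu]_(u in `]0%R, +oo[)
      ((expR (- s))%:E * (u `^ (x - 1) * expR (- (s * u)))%:E))%E; last first.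
    by apply: eq_integral => u _; rewrite -EFinM mulrA.
  rewrite ge0_integralZl.
  - rewrite (laplace_powR _ s0) muleA -EFinM mulrC.
    by rewrite (_ : 1 - x - 1 = - x); last by ring.
  - exact: measurable_itv.
  - exact: measurable_powR_expRN.
  - by move=> u _; rewrite lee_fin mulr_ge0 ?powR_ge0 ?expR_ge0.
  - by rewrite lee_fin expR_ge0.
rewrite H.
- apply: eq_integral => u; rewrite inE/= in_itv/= andbT => u0.
  have u10 : 0 < 1 + u by rewrite addr_gt0.
  transitivity (\int[mu]_(s in `]0%R, +oo[)
      ((u `^ (x - 1))%:E * (expR (- ((1 + u) * s)))%:E))%E.
    apply: eq_integral => s _; rewrite -EFinM mulrAC -expRD mulrC.
    by congr (_ * expR _)%:E; ring.
  have m1 : measurable_fun setT (fun s : R => (expR (- ((1 + u) * s)))%:E).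
    by apply/measurable_EFinP; exact: measurable_expRNM.
  rewrite ge0_integralZl.
  - rewrite integral_itv_obnd_cbnd; last exact: measurable_funTS.
    by rewrite (integraly_expRN _ u10) mulr0 oppr0 expR0 div1r -EFinM.
  - exact: measurable_itv.
  - exact: measurable_funTS.
  - by move=> s _; rewrite lee_fin expR_ge0.
  - by rewrite lee_fin powR_ge0.
- exact: measurable_itv.
- exact: measurable_itv.
- apply: (@measurable_laplace_kernel _ _ _ (fun s : R => expR (- s))
    (fun u : R => u `^ (x - 1)) id id).
  + exact: measurable_itv.
  + exact: measurable_itv.
  + exact: measurable_funTS.
  + by apply: measurable_funTS; exact: measurable_powR.
  + exact: measurable_id.
  + exact: measurable_id.
- by move=> s u _ _; rewrite lee_fin !mulr_ge0 ?powR_ge0 ?expR_ge0.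
Qed.

(** With [v = w^3], the identity
    [(1 + w^2) / (1 + w^3) = 1 / (1 + w) + w / (1 + w^3)] splits the
    sum of the kernels on the left into [v^(x/3-1) / (1 + w)], whose integral is
    [3 Beta x] by the substitution [v = u^3], and the kernel at [(x + 1) / 3].
    The terms are arranged so that everything is nonnegative. *)
Lemma integral_beta_ker_triplication (R : realType) (x : R) :
  (\int[mu]_(u in `]0%R, +oo[) (beta_ker (x / 3) u)%:E +
   \int[mu]_(u in `]0%R, +oo[) (beta_ker ((x + 2) / 3) u)%:E =
   3%:E * \int[mu]_(u in `]0%R, +oo[) (beta_ker x u)%:E +
   \int[mu]_(u in `]0%R, +oo[) (beta_ker ((x + 1) / 3) u)%:E)%E.
Proof.
have mb (y : R) : measurable_fun (`]0, +oo[%classic : set R) (fun u => (beta_ker y u)%:E).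
  by apply/measurable_EFinP; exact: measurable_beta_ker.
have b0 (y u : R) : `]0, +oo[%classic u -> (0 <= (beta_ker y u)%:E)%E.
  by rewrite /= in_itv/= andbT lee_fin; exact: beta_ker_ge0.
(* The image of the kernel at x under the substitution v = u^3. *)
pose G (v : R) := v `^ (x / 3 - 1) / (1 + v `^ 3^-1).
have G0 (v : R) : 0 < v -> 0 <= G v.
  by move=> v0; rewrite divr_ge0 ?powR_ge0// addr_ge0// powR_ge0.
have cG (v : R) : 0 < v -> {for v, continuous G}.
  move=> v0; apply: cvgM; first exact: continuous_powR.
  apply: cvgV; first by rewrite gt_eqF// ltr_wpDr// powR_ge0.
  by apply: cvgD; [exact: cvg_cst|exact: continuous_powR].
have mG : measurable_fun (`]0%R, +oo[%classic : set R) (fun u : R => (G u)%:E).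
  apply/measurable_EFinP; apply: open_continuous_measurable_fun; first exact: interval_open.
  by move=> u; rewrite inE/= in_itv/= andbT => u0; exact: cG.
have eG : (3%:E * \int[mu]_(u in `]0%R, +oo[) (beta_ker x u)%:E =
    \int[mu]_(u in `]0%R, +oo[) (G u)%:E)%E.
  have r3 := @ray_param_powR R 3 (ltr0n _ _).
  rewrite -(ray_change_of_variables r3 cG G0) -ge0_integralZl; first last.
  - by rewrite lee_fin.
  - by move=> u; exact: b0.
  - exact: mb.
  - exact: measurable_itv.
  apply: eq_integral => u; rewrite inE/= in_itv/= andbT => u0.
  rewrite -EFinM (derive_powR _ u0) /G -!powRrM mulfV ?pnatr_eq0//.
  rewrite (powRr1 (ltW u0)) /beta_ker; congr EFin.
  have -> : u `^ (x - 1) = u `^ (3 * (x / 3 - 1)) * u `^ (3 - 1).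
    rewrite -powRD; last by rewrite (gt_eqF u0) implybT.
    by congr (_ `^ _); field.
  by ring.
have G0' (u : R) : `]0, +oo[%classic u -> (0 <= (G u)%:E)%E.
  by rewrite /= in_itv/= andbT lee_fin; exact: G0.
have addI (p q : R -> R) : (forall u, `]0, +oo[%classic u -> (0 <= (p u)%:E)%E) ->
    measurable_fun (`]0, +oo[%classic : set R) (fun u => (p u)%:E) ->
    (forall u, `]0, +oo[%classic u -> (0 <= (q u)%:E)%E) ->
    measurable_fun (`]0, +oo[%classic : set R) (fun u => (q u)%:E) ->
    (\int[mu]_(u in `]0%R, +oo[) (p u)%:E + \int[mu]_(u in `]0%R, +oo[) (q u)%:E =
     \int[mu]_(u in `]0%R, +oo[) ((p u)%:E + (q u)%:E))%E.
  move=> p0 mp q0 mq; rewrite ge0_integralD.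
  - by [].
  - exact: measurable_itv.
  - exact: p0.
  - exact: mp.
  - exact: q0.
  - exact: mq.
rewrite eG (addI _ _ (b0 _) (mb _) (b0 _) (mb _)) (addI _ _ G0' mG (b0 _) (mb _)).
apply: eq_integral => v; rewrite inE/= in_itv/= andbT => v0.
rewrite -!EFinD; congr EFin; rewrite /beta_ker /G.
pose w := v `^ 3^-1.
have w0 : 0 < w by exact: powR_gt0.
have w3 : v = w ^+ 3.
  by rewrite /w -powR_mulrn ?powR_ge0// -powRrM mulVf ?pnatr_eq0// powRr1// ltW.
have -> : v `^ ((x + 2) / 3 - 1) = v `^ (x / 3 - 1) * w ^+ 2.
  rewrite /w -powR_mulrn ?powR_ge0// -powRrM -powRD; last by rewrite (gt_eqF v0) implybT.
  by congr (_ `^ _); field.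
have -> : v `^ ((x + 1) / 3 - 1) = v `^ (x / 3 - 1) * w.
  rewrite /w -powRD; last by rewrite (gt_eqF v0) implybT.
  by congr (_ `^ _); field.
have v10 : 1 + v != 0 by rewrite gt_eqF// addr_gt0.
have w10 : 1 + w != 0 by rewrite gt_eqF// addr_gt0.
rewrite -/w; move: v10; rewrite w3 => v10; field.
by rewrite w10 v10.
Qed.

(** * Lipschitz regularity of the beta integral *)

(** [cutoff u] has the behaviour of [1 / (1 + u)] at [0] and at infinity, and
    an explicit Mellin transform: it carries the poles [1/x] and [1/(1-x)] of the
    beta integral. *)
Definition cutoff (R : realType) (u : R) : R := Num.min 1 u^-1.

Lemma cutoff_small (R : realType) (u : R) : 0 < u -> u <= 1 -> cutoff u = 1.
Proof. by move=> u0 u1; rewrite /cutoff (min_idPl _)// invf_ge1. Qed.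

Lemma cutoff_large (R : realType) (u : R) : 1 <= u -> cutoff u = u^-1.
Proof.
by move=> u1; rewrite /cutoff (min_idPr _)// invf_le1// (lt_le_trans ltr01).
Qed.

Lemma cutoff_ge0 (R : realType) (u : R) : 0 < u -> 0 <= cutoff u.
Proof. by move=> u0; rewrite /cutoff le_min ler01/= invr_ge0 ltW. Qed.

Lemma le_inv_cutoff (R : realType) (u : R) : 0 < u -> (1 + u)^-1 <= cutoff u.
Proof.
move=> u0; rewrite /cutoff le_min; apply/andP; split.
  by rewrite invf_le1 ?addr_gt0// lerDl ltW.
by rewrite lef_pV2 ?posrE ?addr_gt0// lerDr ler01.
Qed.

Lemma continuous_cutoff (R : realType) (u : R) :
  0 < u -> {for u, continuous (@cutoff R)}.
Proof.
move=> u0; apply: (@continuous_min _ _ (cst 1) (fun u : R => u^-1)).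
  exact: cvg_cst.
by apply: cvgV; [rewrite gt_eqF|exact: cvg_id].
Qed.

Lemma is_derive_powR_primitive (R : realType) (x u : R) : x != 0 -> 0 < u ->
  is_derive u 1 (fun v : R => x^-1 * v `^ x) (u `^ (x - 1)).
Proof.
move=> x0 u0; have dE := is_derive1_powR x u0.
have -> : u `^ (x - 1) = x^-1 * (x * u `^ (x - 1)) by rewrite mulKf.
exact: is_deriveZ.
Qed.

Lemma integral_powR_0b (R : realType) (x b : R) : 0 < x -> 0 < b ->
  (\int[mu]_(u in `]0%R, b[) (u `^ (x - 1))%:E = (x^-1 * b `^ x)%:E)%E.
Proof.
move=> x0 b0; have xN0 : x != 0 by rewrite gt_eqF.
rewrite (@ge0_FTC2_oo _ _ (fun v : R => x^-1 * v `^ x)).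
- by rewrite (powR0 xN0) mulr0 subr0.
- exact: b0.
- by move=> u _; exact: powR_ge0.
- by move=> u; rewrite in_itv/= => /andP[u0 _]; exact: continuous_powR.
- split.
  + move=> u; rewrite in_itv/= => /andP[u0 _].
    by have [] := is_derive_powR_primitive xN0 u0.
  + by rewrite (powR0 xN0); apply: cvgM; [exact: cvg_cst|exact: powR_cvg0].
  + apply: cvg_at_left_filter.
    by apply: cvgM; [exact: cvg_cst|exact: continuous_powR].
- move=> u; rewrite in_itv/= => /andP[u0 _]; rewrite derive1E.
  by have [_ ->] := is_derive_powR_primitive xN0 u0.
Qed.

Lemma continuous_powR_cutoff (R : realType) (x u : R) :
  0 < u -> {for u, continuous (fun v : R => v `^ (x - 1) * cutoff v)}.
Proof.
by move=> u0; apply: cvgM; [exact: continuous_powR|exact: continuous_cutoff].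
Qed.

Lemma measurable_powR_cutoff (R : realType) (x : R) :
  measurable_fun (`]0, +oo[%classic : set R) (fun v : R => v `^ (x - 1) * cutoff v).
Proof.
apply: open_continuous_measurable_fun; first exact: interval_open.
by move=> u; rewrite inE/= in_itv/= andbT => u0; exact: continuous_powR_cutoff.
Qed.

Lemma integral_powR_cutoff (R : realType) (x : R) : 0 < x -> x < 1 ->
  (\int[mu]_(u in `]0%R, +oo[) (u `^ (x - 1) * cutoff u)%:E =
   (x^-1 + (1 - x)^-1)%:E)%E.
Proof.
move=> x0 x1.
have sp : `]0%R, +oo[%classic = (`]0, 1[ `|` `[1, +oo[)%classic :> set R.
  by apply: itv_bndbnd_setU; rewrite bnd_simp.
have mp := measurable_powR_cutoff x.
rewrite sp ge0_integral_setU.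
- rewrite EFinD; congr (_ + _)%E.
    transitivity (\int[mu]_(u in `]0%R, 1%R[) (u `^ (x - 1))%:E)%E.
      apply: eq_integral => u; rewrite inE/= in_itv/= => /andP[u0 u1].
      by rewrite (cutoff_small u0 (ltW u1)) mulr1.
    by rewrite (integral_powR_0b x0 ltr01) powR1 mulr1.
  have y0 : 0 < 1 - x by rewrite subr_gt0.
  rewrite -(integral1y_powRN y0).
  apply: eq_integral => u; rewrite inE/= in_itv/= andbT => u1.
  have u0 : 0 < u := lt_le_trans ltr01 u1.
  rewrite (cutoff_large u1) -(powR_inv1 (ltW u0)) -powRD; last first.
    by rewrite (gt_eqF u0) implybT.
  by congr (_ `^ _)%:E; ring.
- exact: measurable_itv.
- exact: measurable_itv.
- by apply/measurable_EFinP; rewrite -sp.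
- move=> u; rewrite -sp/= in_itv/= andbT => u0.
  by rewrite lee_fin mulr_ge0 ?powR_ge0 ?cutoff_ge0.
- apply/disj_setPS => u [/=]; rewrite !in_itv/= andbT => /andP[_ u1].
  by rewrite leNgt u1.
Qed.

Lemma integrable_powR_cutoff (R : realType) (x : R) : 0 < x -> x < 1 ->
  mu.-integrable (`]0, +oo[%classic : set R)
    (EFin \o (fun u : R => u `^ (x - 1) * cutoff u)).
Proof.
move=> x0 x1; apply/integrableP; split.
  by apply/measurable_EFinP; exact: measurable_powR_cutoff.
rewrite (_ : (\int[mu]_(u in _) _)%E = (x^-1 + (1 - x)^-1)%:E) ?ltry//.
rewrite -(integral_powR_cutoff x0 x1); apply: eq_integral => u.
rewrite inE/= in_itv/= andbT => u0.
by rewrite ger0_norm// mulr_ge0 ?powR_ge0 ?cutoff_ge0.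
Qed.

Lemma integrable_beta_ker (R : realType) (x : R) : 0 < x -> x < 1 ->
  mu.-integrable (`]0, +oo[%classic : set R) (EFin \o beta_ker x).
Proof.
move=> x0 x1; apply: le_integrable (integrable_powR_cutoff x0 x1).
- exact: measurable_itv.
- by apply/measurable_EFinP; exact: measurable_beta_ker.
- move=> u /=; rewrite in_itv/= andbT => u0; rewrite lee_fin.
  rewrite (ger0_norm (beta_ker_ge0 _ u0)) ger0_norm.
    by rewrite /beta_ker ler_wpM2l ?powR_ge0 ?le_inv_cutoff.
  by rewrite mulr_ge0 ?powR_ge0 ?cutoff_ge0.
Qed.

Lemma expR_lipschitz (R : realType) (p q : R) :
  `|expR p - expR q| <= `|p - q| * Num.max (expR p) (expR q).
Proof.
wlog qp : p q / q <= p.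
  move=> H; have [|/ltW pq] := leP q p; first exact: H.
  by rewrite distrC (distrC p) maxC; exact: H.
have eqp : expR q <= expR p by rewrite ler_expR.
rewrite (max_idPl eqp) ger0_norm ?subr_ge0// ger0_norm ?subr_ge0//.
have -> : expR q = expR p * expR (q - p) by rewrite -expRD; congr expR; ring.
have h := expR_ge1Dx (q - p); have e0 := expR_gt0 p.
rewrite -[X in X - _]mulr1 -mulrBr mulrC ler_wpM2r ?(ltW e0)//.
by rewrite lerBlDr -lerBlDl; apply: le_trans h; lra.
Qed.

Lemma powR_lipschitz (R : realType) (u a b : R) : 0 < u ->
  `|u `^ a - u `^ b| <= `|a - b| * `|ln u| * Num.max (u `^ a) (u `^ b).
Proof.
by move=> u0; rewrite /powR (gt_eqF u0) -normrM mulrBl; exact: expR_lipschitz.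
Qed.

(** Since [cutoff u - 1/(1+u)] is at most [u] near [0] and [u^-2] at infinity,
    it absorbs the worst power of [u], and the factor [ln u] from the mean value
    bound costs only a square root: [|ln u| <= 2 max(u^(1/2), u^(-1/2))]. The
    majorant is again a multiple of the integrand with explicit integral, at
    exponent [1/2]. *)
Lemma powR_sub1_cutoff_le (R : realType) (u x y : R) :
  0 < u -> 0 < x -> x < 1 -> 0 < y -> y < 1 ->
  `|u `^ (x - 1) - u `^ (y - 1)| * (cutoff u - (1 + u)^-1) <=
  `|x - y| * 2 * (u `^ (2^-1 - 1) * cutoff u).
Proof.
move=> u0 x0 x1 y0 y1.
have cu : 0 <= cutoff u - (1 + u)^-1 by rewrite subr_ge0 le_inv_cutoff.
have P (a : R) : u `^ a = u * u `^ (a - 1).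
  rewrite -[X in X * _](powRr1 (ltW u0)) -powRD; last by rewrite (gt_eqF u0) implybT.
  by congr (_ `^ _); ring.
have u10 : 0 < 1 + u by rewrite addr_gt0.
apply: (le_trans (ler_wpM2r cu (powR_lipschitz _ _ u0))).
rewrite (_ : x - 1 - (y - 1) = x - y); last by ring.
rewrite -!mulrA ler_wpM2l//.
have hN : (2^-1 : R) - 1 = - 2^-1 by field.
have [u1|/ltW u1] := leP u 1.
- rewrite (cutoff_small u0 u1) mulr1 hN.
  have l1 : `|ln u| <= 2 * u `^ (- 2^-1).
    rewrite ler0_norm ?ln_le0//.
    have := ln_sublinear (powR_gt0 (- 2^-1) u0); rewrite ln_powR => /ltW; lra.
  have l2 : Num.max (u `^ (x - 1)) (u `^ (y - 1)) * (1 - (1 + u)^-1) <= 1.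
    have hu : 1 - (1 + u)^-1 <= u.
      rewrite -subr_ge0 (_ : u - _ = u ^+ 2 / (1 + u)) ?divr_ge0 ?sqr_ge0 ?ltW//.
      by field; rewrite gt_eqF.
    have le1 (a : R) : 0 < a -> u `^ (a - 1) * u <= 1.
      move=> a0; rewrite mulrC -P -(powRr0 u).
      by apply: ger_powR; [rewrite u0 u1|exact: ltW].
    have m0 : 0 <= Num.max (u `^ (x - 1)) (u `^ (y - 1)) by rewrite le_max powR_ge0.
    apply: (le_trans (ler_wpM2l m0 hu)).
    by have [_|_] := leP (u `^ (x - 1)) (u `^ (y - 1)); exact: le1.
  rewrite -[leRHS]mulr1; apply: ler_pM => //.
  rewrite mulr_ge0// ?le_max ?powR_ge0// subr_ge0 invf_le1// lerDl ltW//.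
- rewrite (cutoff_large u1) hN.
  have l1 : `|ln u| <= 2 * u `^ 2^-1.
    rewrite ger0_norm ?ln_ge0//.
    have := ln_sublinear (powR_gt0 2^-1 u0); rewrite ln_powR => /ltW; lra.
  have hh : u `^ (- 2^-1) * u^-1 = u `^ 2^-1 * u ^- 2.
    rewrite (P (2^-1)) (_ : 2^-1 - 1 = - 2^-1)//.
    by field; rewrite gt_eqF.
  rewrite hh (mulrA 2); apply: ler_pM => //.
    rewrite mulr_ge0 ?le_max ?powR_ge0//.
    by rewrite subr_ge0 lef_pV2 ?posrE// lerDr.
  have m0 : 0 <= Num.max (u `^ (x - 1)) (u `^ (y - 1)) by rewrite le_max powR_ge0.
  have le1 (a : R) : a < 1 -> u `^ (a - 1) <= 1.
    move=> a1; rewrite -[leRHS](powRr0 u).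
    by apply: ler_powR => //; rewrite subr_le0 ltW.
  rewrite -[leRHS]mul1r; apply: ler_pM => //.
  - by rewrite subr_ge0 lef_pV2 ?posrE// lerDr.
  - by rewrite ge_max !le1.
  - rewrite -subr_ge0 (_ : _ - _ = (u ^+ 2 * (1 + u))^-1).
      by rewrite invr_ge0 mulr_ge0 ?sqr_ge0// ltW.
    by field; rewrite !gt_eqF.
Qed.

Definition Beta (R : realType) (x : R) : R :=
  \int[mu]_(u in `]0, +oo[) beta_ker x u.

(** The constant is [2 (1/x + 1/(1-x))] at [x = 1/2], the integral of the
    majorant of [powR_sub1_cutoff_le] divided by [|x - y|]. *)
Lemma Beta_lipschitz (R : realType) (x y : R) :
  0 < x -> x < 1 -> 0 < y -> y < 1 ->
  `|(Beta x - (x^-1 + (1 - x)^-1)) - (Beta y - (y^-1 + (1 - y)^-1))| <=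
  8 * `|x - y|.
Proof.
move=> x0 x1 y0 y1.
pose g (z u : R) := u `^ (z - 1) * cutoff u - beta_ker z u.
have gE (z u : R) : g z u = u `^ (z - 1) * (cutoff u - (1 + u)^-1).
  by rewrite /g /beta_ker mulrBr.
have ig (z : R) : 0 < z -> z < 1 ->
    mu.-integrable (`]0, +oo[%classic : set R) (EFin \o g z).
  move=> z0 z1.
  rewrite (_ : EFin \o g z =
    ((fun u : R => (u `^ (z - 1) * cutoff u)%:E) \- (fun u : R => (beta_ker z u)%:E))%E).
    apply: integrableB => //; first exact: integrable_powR_cutoff.
    exact: integrable_beta_ker.
  by apply/funext => u.
have Ig (z : R) : 0 < z -> z < 1 ->
    \int[mu]_(u in `]0, +oo[) g z u = z^-1 + (1 - z)^-1 - Beta z.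
  move=> z0 z1; rewrite /g RintegralB//=; last 2 first.
  - exact: integrable_powR_cutoff.
  - exact: integrable_beta_ker.
  by rewrite /Rintegral (integral_powR_cutoff z0 z1).
have h0 : (0 : R) < 2^-1 by rewrite invr_gt0.
have h1 : (2^-1 : R) < 1 by rewrite invf_lt1// ltr1n.
have iD : mu.-integrable (`]0, +oo[%classic : set R) (EFin \o (fun u => g x u - g y u)).
  rewrite (_ : EFin \o _ = ((fun u : R => (g x u)%:E) \- (fun u : R => (g y u)%:E))%E).
    by apply: integrableB => //; exact: ig.
  by apply/funext => u.
rewrite (_ : _ - _ = - (\int[mu]_(u in `]0, +oo[) (g x u - g y u))); last first.
  rewrite RintegralB//; [|exact: ig|exact: ig].
  by rewrite (Ig _ x0 x1) (Ig _ y0 y1); ring.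
rewrite normrN; apply: le_trans.
  by apply: le_normr_Rintegral; [exact: measurable_itv|exact: iD].
have -> : 8 * `|x - y| =
    \int[mu]_(u in `]0, +oo[) (`|x - y| * 2 * (u `^ (2^-1 - 1) * cutoff u)).
  rewrite RintegralZl//; last exact: integrable_powR_cutoff.
  by rewrite /Rintegral (integral_powR_cutoff h0 h1)/=; field.
apply: le_Rintegral => //.
- exact: integrable_norm.
- have := integrableZl _ (`|x - y| * 2) (integrable_powR_cutoff h0 h1).
  by apply; exact: measurable_itv.
- move=> u /=; rewrite in_itv/= andbT => u0.
  rewrite !gE -mulrBl normrM [X in _ * X]ger0_norm; last first.
    by rewrite subr_ge0 le_inv_cutoff.
  exact: powR_sub1_cutoff_le.
Qed.

(** * Lipschitz regularity of the cosecant *)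

Lemma ge0_of_derive_ge0 (R : realType) (f df : R -> R) (y : R) :
  (forall x : R, is_derive x 1 f (df x)) -> f 0 = 0 ->
  (forall x, 0 <= x -> 0 <= df x) -> 0 <= y -> 0 <= f y.
Proof.
move=> fd f0 df0; rewrite le_eqVlt => /predU1P[<-|y0]; first by rewrite f0.
have [|c cy] := @MVT R f df 0 y y0 (fun x _ => fd x).
  by apply: derivable_within_continuous => x _; have [] := fd x.
rewrite f0 !subr0 => ->; rewrite mulr_ge0 ?(ltW y0)// df0//.
by move: cy; rewrite in_itv/= => /andP[/ltW].
Qed.

Lemma sin_le_id (R : realType) (y : R) : 0 <= y -> sin y <= y.
Proof.
rewrite -(subr_ge0 (sin y)).
apply: (@ge0_of_derive_ge0 _ (fun x => x - sin x) (fun x => 1 - cos x)).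
- by rewrite sin0 subrr.
- by move=> x _; rewrite subr_ge0 cos_le1.
Qed.

Lemma cos_ge_taylor2 (R : realType) (y : R) : 0 <= y -> 1 - y ^+ 2 / 2 <= cos y.
Proof.
rewrite -(subr_ge0 _ (cos y)).
apply: (@ge0_of_derive_ge0 _ (fun x => cos x - (1 - x ^+ 2 / 2)) (fun x => x - sin x)).
- by move=> x; apply: is_derive_eq; rewrite /GRing.scale/=; field.
- by rewrite cos0 expr0n/= mul0r subr0 subrr.
- by move=> x x0; rewrite subr_ge0 sin_le_id.
Qed.

Lemma sin_ge_taylor3 (R : realType) (y : R) : 0 <= y -> y - y ^+ 3 / 6 <= sin y.
Proof.
rewrite -(subr_ge0 _ (sin y)).
apply: (@ge0_of_derive_ge0 _ (fun x => sin x - (x - x ^+ 3 / 6))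
  (fun x => cos x - (1 - x ^+ 2 / 2))).
- by move=> x; apply: is_derive_eq; rewrite /GRing.scale/=; field.
- by rewrite sin0 expr0n/= mul0r subr0 subrr.
- by move=> x x0; rewrite subr_ge0 cos_ge_taylor2.
Qed.

(** The double pole of [cos / sin^2] at [0] cancels: the numerator
    [sin^2 y - y^2 cos y] is [O(y^4)] by the Taylor bounds, and
    [sin y >= y / 3] on [(0, 2]]. *)
Lemma cos_sin2_near_inv2 (R : realType) (y : R) : 0 < y -> y <= 2 ->
  `|y ^- 2 - cos y / sin y ^+ 2| <= 9 / 2.
Proof.
move=> y0 y2.
have s1 := sin_le_id (ltW y0); have s3 := sin_ge_taylor3 (ltW y0).
have c2 := cos_ge_taylor2 (ltW y0); have c1 := cos_le1 y.
set s := sin y in s1 s3 *; set c := cos y in c1 c2 *.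
have ys : y / 3 <= s by apply: le_trans s3; nra.
have s0 : 0 < s by apply: lt_le_trans ys; rewrite divr_gt0.
have -> : y ^- 2 - c / s ^+ 2 = (s ^+ 2 - y ^+ 2 * c) / (y ^+ 2 * s ^+ 2).
  by field; rewrite !gt_eqF.
rewrite normrM normfV (gtr0_norm (mulr_gt0 (exprn_gt0 2 y0) (exprn_gt0 2 s0))).
rewrite ler_pdivrMr ?mulr_gt0 ?exprn_gt0//.
have lo : y ^+ 4 / 2 <= 9 / 2 * (y ^+ 2 * s ^+ 2).
  have : (y / 3) ^+ 2 <= s ^+ 2 by rewrite ler_sqr ?nnegrE ?divr_ge0// ltW.
  have : 0 <= y ^+ 2 by rewrite sqr_ge0.
  rewrite (_ : y ^+ 4 = y ^+ 2 * y ^+ 2); last by rewrite -exprD.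
  rewrite expr_div_n; nra.
apply: le_trans lo; rewrite ler_norml; apply/andP; split.
- have h1 : (y - y ^+ 3 / 6) ^+ 2 <= s ^+ 2.
    rewrite ler_sqr ?nnegrE//; last exact: ltW.
    rewrite (_ : _ - _ = y * (1 - y ^+ 2 / 6)); last by ring.
    by rewrite mulr_ge0 ?(ltW y0)//; nra.
  have h2 : y ^+ 2 * c <= y ^+ 2 by rewrite ler_piMr ?sqr_ge0.
  have h3 : 0 <= y ^+ 6 by rewrite exprn_ge0// ltW.
  have h4 : 0 <= y ^+ 4 by rewrite exprn_ge0// ltW.
  have h5 : (y - y ^+ 3 / 6) ^+ 2 = y ^+ 2 - y ^+ 4 / 3 + y ^+ 6 / 36 by field.
  lra.
- have h1 : s ^+ 2 <= y ^+ 2 by rewrite ler_sqr ?nnegrE// ltW.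
  have h2 : y ^+ 2 * (1 - y ^+ 2 / 2) <= y ^+ 2 * c by rewrite ler_wpM2l ?sqr_ge0.
  have h3 : y ^+ 2 * (1 - y ^+ 2 / 2) = y ^+ 2 - y ^+ 4 / 2 by field.
  lra.
Qed.

(** [pi / sin(pi x)] with its poles at [0] and [1] removed: the same poles as
    those of the beta integral in [Beta_lipschitz]. *)
Definition csc_reg (R : realType) (x : R) : R :=
  pi / sin (pi * x) - (x^-1 + (1 - x)^-1).

(** The derivative of [csc_reg] on [(0, 1)]. *)
Definition csc_reg' (R : realType) (x : R) : R :=
  - (pi ^+ 2 * cos (pi * x) / sin (pi * x) ^+ 2) + x ^- 2 - (1 - x) ^- 2.

Lemma sin_pi_gt0 (R : realType) (x : R) : 0 < x -> x < 1 -> 0 < sin (pi * x).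
Proof.
by move=> x0 x1; rewrite sin_gt0_pi// mulr_gt0 ?pi_gt0//= gtr_pMr ?pi_gt0.
Qed.

Lemma is_derive_csc_reg (R : realType) (x : R) : 0 < x -> x < 1 ->
  is_derive x 1 (@csc_reg R) (csc_reg' x).
Proof.
move=> x0 x1; have s0 := sin_pi_gt0 x0 x1.
have y0 : 0 < 1 - x by rewrite subr_gt0.
have d1 : is_derive x 1 (fun z : R => sin (pi * z)) (pi * cos (pi * x)).
  by apply: is_derive_eq; rewrite /GRing.scale/=; ring.
have d2 := is_deriveV (lt0r_neq0 s0) d1.
have d3 := is_deriveV (lt0r_neq0 x0) (is_derive_id x 1).
have d4' : is_derive x 1 (fun z : R => 1 - z) (- 1).
  by apply: is_derive_eq; ring.
have d4 := @is_deriveV _ (fun z : R => 1 - z) x _ _ (lt0r_neq0 y0) d4'.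
have -> : csc_reg' x = pi * (- sin (pi * x) ^- 2 *: (pi * cos (pi * x))) -
    ((- x ^- 2 *: 1) + (- (1 - x) ^- 2 *: (- 1))).
  by rewrite /csc_reg' /GRing.scale/=; field; rewrite !gt_eqF.
exact: is_deriveB.
Qed.

Lemma csc_reg'_sym (R : realType) (x : R) : csc_reg' (1 - x) = - csc_reg' x.
Proof.
rewrite /csc_reg' (_ : pi * (1 - x) = pi - pi * x); last by ring.
have -> : sin (pi - pi * x) = sin (pi * x) by rewrite sinB sinpi cospi; ring.
have -> : cos (pi - pi * x) = - cos (pi * x) by rewrite cosB sinpi cospi; ring.
by rewrite subKr; ring.
Qed.

(** By the symmetry [x -> 1 - x] it suffices to look at [x <= 1/2], where only
    the pole at [0] matters. *)
Lemma csc_reg'_bound (R : realType) (x : R) : 0 < x -> x < 1 ->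
  `|csc_reg' x| <= pi ^+ 2 * (9 / 2) + 4.
Proof.
wlog x2 : x / x <= 2^-1.
  move=> H x0 x1; have [|/ltW x2] := leP x 2^-1; first by move=> /H; exact.
  by rewrite -normrN -csc_reg'_sym; apply: H; lra.
move=> x0 x1; have pi0 := pi_gt0 R.
have y0 : 0 < pi * x by rewrite mulr_gt0.
have y2 : pi * x <= 2 by have := pihalf_lt2 R; nra.
have := cos_sin2_near_inv2 y0 y2; set k := _ - _ => kb.
have kE : csc_reg' x = pi ^+ 2 * k - (1 - x) ^- 2.
  have s0 := sin_pi_gt0 x0 x1.
  have z0 : 0 < 1 - x by lra.
  rewrite /csc_reg' /k; move: (sin _) (cos _) s0 => s c s0.
  move: {k kb y0 y2} pi pi0 => p p0.
  by field; rewrite !gt_eqF.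
rewrite kE; apply: (le_trans (ler_normB _ _)); apply: lerD.
  rewrite normrM ger0_norm ?sqr_ge0// ler_wpM2l ?sqr_ge0//.
rewrite ger0_norm ?invr_ge0 ?sqr_ge0//.
have : 2^-1 <= 1 - x by lra.
rewrite (_ : 4 = (2^-1 ^+ 2)^-1 :> R); last by field.
move=> h; rewrite lef_pV2 ?posrE ?exprn_gt0 ?ler_sqr ?nnegrE//; lra.
Qed.

Lemma csc_reg_lipschitz (R : realType) (x y : R) :
  0 < x -> x < 1 -> 0 < y -> y < 1 ->
  `|csc_reg x - csc_reg y| <= (pi ^+ 2 * (9 / 2) + 4) * `|x - y|.
Proof.
wlog xy : x y / y < x.
  move=> H x0 x1 y0 y1; have [->|] := eqVneq x y; first by rewrite !subrr normr0 mulr0.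
  rewrite neq_lt => /orP[xy|yx]; last exact: H.
  by rewrite distrC (distrC x); exact: H.
move=> x0 x1 y0 y1.
have d (z : R) : z \in `[y, x] -> is_derive z 1 (@csc_reg R) (csc_reg' z).
  rewrite in_itv/= => /andP[yz zx]; apply: is_derive_csc_reg.
    exact: lt_le_trans yz.
  exact: le_lt_trans x1.
have cl : {within `[y, x], continuous (@csc_reg R)}.
  by apply: derivable_within_continuous => z zxy; have [] := d z zxy.
have dl (z : R) : z \in `]y, x[ -> is_derive z 1 (@csc_reg R) (csc_reg' z).
  by move=> zxy; apply: d; exact: subset_itv_oo_cc zxy.
have [c cyx ->] := MVT xy dl cl.
rewrite normrM ler_wpM2r ?normr_ge0//; move: cyx; rewrite in_itv/= => /andP[yc cx].
by apply: csc_reg'_bound; [exact: lt_trans yc|exact: lt_trans x1].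
Qed.

(** * Euler's reflection formula *)

(** [cos(pi/3)] is the positive root of [4 c^3 - 3 c + 1 = (c + 1)(2 c - 1)^2],
    the triple angle formula at [cos pi = -1]. *)
Lemma cos_pithird (R : realType) : cos (pi / 3) = 2^-1 :> R.
Proof.
have pi0 := pi_gt0 R.
have c0 : 0 < cos (pi / 3) :> R.
  by apply: cos_gt0_pihalf; apply/andP; split; lra.
have h : 4 * cos (pi / 3) ^+ 3 - 3 * cos (pi / 3) + 1 = 0 :> R.
  have := @cospi R; rewrite {1}(_ : pi = pi / 3 + pi / 3 + pi / 3); last by field.
  rewrite !cosD sinD; have := cos2Dsin2 (pi / 3 : R).
  move: (cos _) (sin _) => c s e1 e2.
  have s2 : s ^+ 2 = 1 - c ^+ 2 by rewrite -e1; ring.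
  have : c ^+ 3 - 3 * s ^+ 2 * c = -1 by rewrite -e2; ring.
  by rewrite s2; lra.
have : (cos (pi / 3) + 1) * (2 * cos (pi / 3) - 1) ^+ 2 = 0 :> R.
  by rewrite -h; ring.
move/eqP; rewrite mulf_eq0 gt_eqF/=; last by rewrite addr_gt0.
by rewrite expf_eq0/= subr_eq0 => /eqP e; lra.
Qed.

(** The analogue for the cosecant of the functional equation of the beta
    integral. It rests on
    [sin(3 y) = 4 sin(y) sin(y + pi/3) sin(y + 2 pi/3)], with [y = pi x / 3]. *)
Lemma csc_triplication (R : realType) (x : R) : 0 < x -> x < 1 ->
  pi / sin (pi * (x / 3)) + pi / sin (pi * ((x + 2) / 3)) =
  3 * (pi / sin (pi * x)) + pi / sin (pi * ((x + 1) / 3)).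
Proof.
move=> x0 x1.
have a0 : 0 < sin (pi * (x / 3)) by apply: sin_pi_gt0; lra.
have b0 : 0 < sin (pi * ((x + 1) / 3)) by apply: sin_pi_gt0; lra.
have c0 : 0 < sin (pi * ((x + 2) / 3)) by apply: sin_pi_gt0; lra.
have d0 : 0 < sin (pi * x) by exact: sin_pi_gt0.
pose y := pi * (x / 3).
have c3 := cos_pithird R; have e3 := cos2Dsin2 (pi / 3 : R).
have ey := cos2Dsin2 y.
have bE : sin (pi * ((x + 1) / 3)) = 2^-1 * sin y + sin (pi / 3) * cos y.
  rewrite (_ : pi * _ = y + pi / 3); last by rewrite /y; field.
  by rewrite sinD c3; ring.
have cE : sin (pi * ((x + 2) / 3)) = sin (pi / 3) * cos y - 2^-1 * sin y.
  rewrite (_ : pi * _ = pi - (pi / 3 - y)); last by rewrite /y; field.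
  by rewrite sinB sinpi cospi sinB c3; ring.
have dE : sin (pi * x) = 4 * sin y * sin (pi * ((x + 1) / 3)) * sin (pi * ((x + 2) / 3)).
  rewrite bE cE (_ : pi * x = y + y + y); last by rewrite /y; field.
  rewrite !sinD cosD.
  have : sin (pi / 3) ^+ 2 = 3 / 4 :> R by move: e3; rewrite c3; lra.
  move: ey; move: (sin y) (cos y) (sin (pi / 3)) => s c d ey ed.
  have -> : 4 * s * (2^-1 * s + d * c) * (d * c - 2^-1 * s) =
     4 * s * (d ^+ 2 * c ^+ 2 - s ^+ 2 / 4) by field.
  by rewrite ed; field.
have bc : sin (pi * ((x + 1) / 3)) - sin (pi * ((x + 2) / 3)) = sin y.
  by rewrite bE cE; field.
have key : sin y ^+ 2 + sin (pi * ((x + 1) / 3)) * sin (pi * ((x + 2) / 3)) = 3 / 4.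
  have : sin (pi / 3) ^+ 2 = 3 / 4 :> R by move: e3; rewrite c3; lra.
  rewrite bE cE; move: ey; move: (sin y) (cos y) (sin (pi / 3)) => s c d ey ed.
  have -> : (2^-1 * s + d * c) * (d * c - 2^-1 * s) =
     d ^+ 2 * c ^+ 2 - s ^+ 2 / 4 by field.
  by rewrite ed; lra.
rewrite -/y in a0 *; rewrite dE.
move: bc key a0 b0 c0.
move: (sin y) (sin (pi * ((x + 1) / 3))) (sin (pi * ((x + 2) / 3))).
move=> s b c bc key s0 b0 c0.
have -> : pi / s + pi / c = pi * (1 / s + 1 / c) by ring.
have -> : 3 * (pi / (4 * s * b * c)) + pi / b =
    pi * (3 / (4 * s * b * c) + 1 / b) by ring.
congr (_ * _); apply/eqP; rewrite -subr_eq0; apply/eqP.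
have -> : 1 / s + 1 / c - (3 / (4 * s * b * c) + 1 / b) =
    (b * c + s * (b - c) - 3 / 4) / (s * b * c).
  by field; rewrite !gt_eqF.
by rewrite bc -key -expr2 (addrC (b * c)) subrr mul0r.
Qed.

(** The equation expresses [3 h] through three values of [h] at arguments
    contracted by [3], so it divides every Lipschitz constant of [h] by [3]. Hence
    [h] is constant, and the equation [3 c = c - c + c] makes it zero. *)
Lemma triplication_lipschitz_eq0 (R : realType) (h : R -> R) (L : R) :
  (forall x y, 0 < x -> x < 1 -> 0 < y -> y < 1 -> `|h x - h y| <= L * `|x - y|) ->
  (forall x, 0 < x -> x < 1 ->
     3 * h x = h (x / 3) - h ((x + 1) / 3) + h ((x + 2) / 3)) ->
  forall x, 0 < x -> x < 1 -> h x = 0.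
Proof.
move=> hL h3.
have step (k : nat) (x y : R) : 0 < x -> x < 1 -> 0 < y -> y < 1 ->
    `|h x - h y| <= L / 3 ^+ k * `|x - y|.
  elim: k x y => [|k IH] x y x0 x1 y0 y1; first by rewrite expr0 divr1 hL.
  have third (j : R) : 0 <= j -> j <= 2 ->
      `|h ((x + j) / 3) - h ((y + j) / 3)| <= L / 3 ^+ k * (`|x - y| / 3).
    move=> j0 j2; have -> : `|x - y| / 3 = `|(x + j) / 3 - (y + j) / 3|.
      rewrite (_ : (x + j) / 3 - (y + j) / 3 = (x - y) / 3); last by field.
      by rewrite normrM [X in _ = _ * X]ger0_norm ?invr_ge0.
    by apply: IH; lra.
  have t0 := third 0 (lexx _) (ler0n _ _); rewrite !addr0 in t0.
  have t1 := third 1 ler01 (ler1n _ _).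
  have t2 := third 2 (ler0n _ _) (lexx _).
  have e : h x - h y = ((h (x / 3) - h (y / 3)) - (h ((x + 1) / 3) - h ((y + 1) / 3)) +
      (h ((x + 2) / 3) - h ((y + 2) / 3))) / 3.
    by have := h3 x x0 x1; have := h3 y y0 y1; lra.
  rewrite e normrM [X in _ * X <= _]ger0_norm ?invr_ge0// ler_pdivrMr//.
  apply: (le_trans (ler_normD _ _)).
  apply: (le_trans (lerD (ler_normB _ _) (lexx _))).
  apply: (le_trans (lerD (lerD t0 t1) t2)).
  rewrite exprS invfM; lra.
have cst x y : 0 < x -> x < 1 -> 0 < y -> y < 1 -> h x = h y.
  move=> x0 x1 y0 y1; apply/eqP; rewrite -subr_eq0 -normr_le0 leNgt; apply/negP => D0.
  set D := `|_| in D0; pose M := L * `|x - y|.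
  have bnd (k : nat) : D * k%:R <= M.
    have k3 : (k%:R : R) <= 3 ^+ k by rewrite -natrX ler_nat ltnW// ltn_expl.
    have p3 : (0 : R) < 3 ^+ k by rewrite exprn_gt0.
    apply: (le_trans (ler_wpM2l (ltW D0) k3)); rewrite -ler_pdivlMr//.
    by apply: (le_trans (step k x y x0 x1 y0 y1)); rewrite mulrAC.
  have := bnd (Num.truncn (M / D)).+1; rewrite mulrC -ler_pdivlMr//.
  by rewrite leNgt truncnS_gt.
move=> x x0 x1; have := h3 x x0 x1.
rewrite -(cst x (x / 3)) -?(cst x ((x + 1) / 3)) -?(cst x ((x + 2) / 3)); lra.
Qed.

Lemma integral_beta_ker (R : realType) (x : R) : 0 < x -> x < 1 ->
  (\int[mu]_(u in `]0%R, +oo[) (beta_ker x u)%:E = (Beta x)%:E)%E.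
Proof.
move=> x0 x1; rewrite /Beta /Rintegral fineK//.
apply: integrable_fin_num; first exact: measurable_itv.
exact: integrable_beta_ker.
Qed.

Lemma Beta_triplication (R : realType) (x : R) : 0 < x -> x < 1 ->
  3 * Beta x = Beta (x / 3) - Beta ((x + 1) / 3) + Beta ((x + 2) / 3).
Proof.
move=> x0 x1; have := integral_beta_ker_triplication x.
rewrite !integral_beta_ker; [|lra..].
rewrite -EFinM -!EFinD => -[].
move: (Beta _) (Beta _) (Beta _) (Beta _) => p q r s; clear; lra.
Qed.

(** Both sides satisfy the triplication equation and have the same poles at [0]
    and [1], so their difference is Lipschitz on [(0, 1)] and must vanish. *)
Lemma Beta_csc (R : realType) (x : R) : 0 < x -> x < 1 ->
  Beta x = pi / sin (pi * x).
Proof.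
move=> x0 x1; apply/eqP; rewrite -subr_eq0; apply/eqP.
apply: (@triplication_lipschitz_eq0 _ (fun x => Beta x - pi / sin (pi * x))
  (8 + (pi ^+ 2 * (9 / 2) + 4))) x0 x1.
- move=> {}x y x0 x1 y0 y1.
  have b := Beta_lipschitz x0 x1 y0 y1; have c := csc_reg_lipschitz x0 x1 y0 y1.
  rewrite [leRHS]mulrDl; apply: le_trans (lerD b c).
  apply: le_trans (ler_normB _ _).
  rewrite (_ : _ - _ - (csc_reg x - csc_reg y) =
    Beta x - pi / sin (pi * x) - (Beta y - pi / sin (pi * y)))//.
  by rewrite /csc_reg; move: (Beta _) (Beta _) (pi / _) (pi / _) => p q r s; ring.
- move=> {}x x0 x1; have := csc_triplication x0 x1.
  have := Beta_triplication x0 x1.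
  move: (Beta _) (Beta _) (Beta _) (Beta _) (pi / _) (pi / _) (pi / _) (pi / _).
  by clear; move=> p q r s p' q' r' s'; lra.
Qed.

(** Convergence comes from the product with [eGamma (1 - x)], which is
    [pi / sin(pi x)]: two nonnegative extended reals whose product is finite and
    nonzero are both finite. *)
Lemma eGamma_fin_num (R : realType) (x : R) : 0 < x -> x < 1 ->
  eGamma x \is a fin_num.
Proof.
move=> x0 x1; have := eGamma_reflected x.
rewrite integral_beta_ker// Beta_csc//.
have p0 : 0 < pi / sin (pi * x) by rewrite divr_gt0 ?pi_gt0 ?sin_pi_gt0.
have := eGamma_ge0 (1 - x); have := eGamma_ge0 x.
case: (eGamma x) => [g| |] //= _.
case: (eGamma (1 - x)) => [h| |] //= h0.
move: h0; rewrite lee_fin le_eqVlt => /predU1P[<-|h0].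
  by rewrite mule0 => -[] e; rewrite -e ltxx in p0.
by rewrite gt0_mulye.
Qed.

Lemma Gamma_reflection (R : realType) (x : R) : 0 < x -> x < 1 ->
  Gamma x * Gamma (1 - x) = pi / sin (pi * x).
Proof.
move=> x0 x1; rewrite -Beta_csc//.
apply: EFin_inj; rewrite -integral_beta_ker// -eGamma_reflected EFinM.
by congr (_ * _)%E; rewrite /Gamma /Rintegral fineK// eGamma_fin_num//; lra.
Qed.

Lemma eGammaE (R : realType) (x : R) (k : nat) : 0 < x -> x < 1 ->
  eGamma (x + k%:R) = (Gamma (x + k%:R))%:E.
Proof.
move=> x0 x1; rewrite /Gamma /Rintegral fineK//.
elim: k => [|k IH]; first by rewrite addr0; exact: eGamma_fin_num.
rewrite -natr1 addrA -/(eGamma _) eGamma_rec; last by rewrite ltr_wpDr.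
by rewrite fin_numM.
Qed.

Lemma Gamma_rec (R : realType) (x : R) (k : nat) : 0 < x -> x < 1 ->
  Gamma (x + k.+1%:R) = (x + k%:R) * Gamma (x + k%:R).
Proof.
move=> x0 x1; apply: EFin_inj.
rewrite EFinM -!eGammaE// -natr1 addrA eGamma_rec//.
by rewrite ltr_wpDr.
Qed.

(** The left side is [Gamma(alpha) Gamma(n - alpha) c_alpha] for
    [alpha = x + k] and [n = k + 1]: passing from [k] to [k + 1] multiplies
    [Gamma(alpha)] by [x + k], the new factor of the product is
    [-1 / (x + k)], and the sine changes sign. *)
Lemma Gamma_shift_reflection (R : realType) (x : R) (k : nat) :
  0 < x -> x < 1 ->
  Gamma (x + k%:R) * Gamma (1 - x) * (sin (pi * (x + k%:R)) / pi *
    \prod_(1 <= l < k.+1) (l%:R - (x + k%:R))^-1) = 1.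
Proof.
move=> x0 x1; have s0 := sin_pi_gt0 x0 x1; have pi0 := pi_gt0 R.
elim: k => [|k IH].
  rewrite addr0 Gamma_reflection// big_nil mulr1.
  by rewrite mulrA divfK ?gt_eqF// divff// gt_eqF.
have xk : 0 < x + k%:R by rewrite ltr_wpDr.
rewrite Gamma_rec// big_nat_recl//.
rewrite (eq_bigr (fun l : nat => (l%:R - (x + k%:R))^-1)); last first.
  by move=> l _; congr (_^-1); rewrite -!natr1; ring.
have -> : sin (pi * (x + k.+1%:R)) = - sin (pi * (x + k%:R)).
  by rewrite -natr1 -sinDpi; congr sin; ring.
rewrite -[RHS]IH (_ : k.+1%:R = k%:R + 1); last by rewrite natr1.
have -> : 1%:R - (x + (k%:R + 1)) = - (x + k%:R) by ring.
rewrite invrN; move: (bigop _ _ _) (Gamma _) (Gamma _) (sin _) pi^-1 => P g g' s p.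
by move: (x + k%:R) xk => c c0; field; rewrite gt_eqF.
Qed.

(** * The diffusive representation *)

Lemma nat_shift_decomposition (R : realType) (alpha : R) :
  0 < alpha -> alpha \isn't a Num.nat ->
  exists k : nat, exists2 g : R, 0 < g < 1 & alpha = g + k%:R /\ nceil alpha = k.+1.
Proof.
move=> a0 aN; pose k := Num.truncn alpha.
have /andP[ka ak] : k%:R <= alpha < k.+1%:R by apply: truncn_itv; exact: ltW.
have ka' : k%:R < alpha.
  by rewrite lt_neqAle ka andbT; apply: contraNneq aN => <-; exact: natr_nat.
exists k; exists (alpha - k%:R).
  by rewrite subr_gt0 ka'/= ltrBlDl natr1.
split; first by rewrite subrK.
rewrite /nceil (_ : Num.ceil alpha = k.+1)//; apply: ceil_def.
rewrite -addn1 PoszD addrK; apply/andP; split; first by rewrite -pmulrn.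
by rewrite -PoszD addn1 -pmulrn ltW.
Qed.

(** The real-valued form of [ray_laplace_powR], with a constant of any sign. *)
Lemma ray_kernel_integral (R : realType) (Omega : set R) (psi : R -> R)
    (x s C : R) :
  ray_param Omega psi -> 0 < s -> 0 < x -> x < 1 ->
  (\int[mu]_(w in Omega)
     (C * (psi w `^ (x - 1) * expR (- (s * psi w)) * psi^`()%classic w))%:E =
   (C * (s `^ (- x) * Gamma x))%:E)%E.
Proof.
move=> r s0 x0 x1; have mO := ray_measurable r.
have I := ray_laplace_powR x r s0.
have Gx : eGamma x = (Gamma x)%:E by have := @eGammaE _ x 0 x0 x1; rewrite addr0.
rewrite Gx -EFinM in I.
have mk : measurable_fun Omega
    (fun w => psi w `^ (x - 1) * expR (- (s * psi w)) * psi^`()%classic w).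
  apply: open_continuous_measurable_fun; first exact: (ray_open r).
  move=> w; rewrite inE => Ow; have cp := ray_continuous r Ow.
  apply: cvgM; last exact: (ray_C1 r).
  apply: cvgM.
    apply: (@continuous_comp _ _ _ psi (fun v : R => v `^ (x - 1)) w cp).
    by apply: continuous_powR; exact: (ray_gt0 r).
  apply: (@continuous_comp _ _ _ psi (fun v : R => expR (- (s * v))) w cp).
  exact: continuous_expRNM.
have k0 (w : R) : Omega w ->
    0 <= psi w `^ (x - 1) * expR (- (s * psi w)) * psi^`()%classic w.
  by move=> Ow; rewrite !mulr_ge0 ?powR_ge0 ?expR_ge0// (ray_derive_ge0 r).
rewrite EFinM -I -integralZl.
- by apply: eq_integral => w _; rewrite -EFinM.
- exact: mO.
apply/integrableP; split; first exact/measurable_EFinP.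
rewrite (_ : (\int[mu]_(w in Omega) _)%E = (s `^ (- x) * Gamma x)%:E) ?ltry//.
rewrite -I; apply: eq_integral => w; rewrite inE => Ow.
by rewrite gee0_abs// lee_fin k0.
Qed.

Lemma measurable_subr_powR (R : realType) (D : set R) (t p : R) :
  measurable_fun D (fun tau : R => (t - tau) `^ p).
Proof.
apply: measurable_funTS.
apply: (@measurableT_comp _ _ _ _ _ _ (fun v : R => v `^ p) _
  (fun y : R => t - y)).
  exact: measurable_powR.
exact: measurable_funB.
Qed.

Lemma integrable_subr_powR (R : realType) (a t p : R) : a <= t -> 0 < p ->
  mu.-integrable (`[a, t[%classic : set R)
    (EFin \o (fun tau : R => (t - tau) `^ (p - 1))).
Proof.
rewrite le_eqVlt => /predU1P[<- _|at0 p0].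
  by rewrite set_itv_ge ?bnd_simp ?ltxx//; exact: integrable_set0.
have pN0 : p != 0 by rewrite gt_eqF.
pose F (tau : R) : R := - (p^-1 * (t - tau) `^ p).
have cf (x : R) : x < t -> {for x, continuous (fun tau : R => (t - tau) `^ (p - 1))}.
  move=> xt; apply: (@continuous_comp _ _ _ (fun y : R => t - y)
    (fun v : R => v `^ (p - 1))).
    by apply: cvgB; [exact: cvg_cst|exact: cvg_id].
  by apply: continuous_powR; rewrite subr_gt0.
have dF (x : R) : x < t -> is_derive x 1 F ((t - x) `^ (p - 1)).
  move=> xt; have tx0 : 0 < t - x by rewrite subr_gt0.
  have d1 : is_derive x 1 (fun y : R => t - y) (- 1) by apply: is_derive_eq; ring.
  have d2 := is_derive_powR_primitive pN0 tx0.
  have d3 := @is_derive1_comp _ (fun v : R => p^-1 * v `^ p)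
    (fun y : R => t - y) x _ _ d2 d1.
  have := is_deriveN d3; rewrite mulrN1 opprK; exact.
have I : (\int[mu]_(tau in `]a, t[) ((t - tau) `^ (p - 1))%:E = (F t - F a)%:E)%E.
  apply: (ge0_FTC2_oo at0).
  - by move=> x _; exact: powR_ge0.
  - by move=> x; rewrite in_itv/= => /andP[_ xt]; exact: cf.
  - split.
    + by move=> x; rewrite in_itv/= => /andP[_ xt]; have [] := dF x xt.
    + apply: cvg_at_right_filter; apply: derivable1_continuous.
      by have [] := dF a at0.
    + rewrite /F subrr (powR0 pN0) mulr0 -(mulr0 p^-1); apply: cvgN.
      apply: cvgM; first exact: cvg_cst.
      apply/cvgrPdist_lt => e e0.
      have /cvgrPdist_lt/(_ e e0)[d /= d0 dH] := powR_cvg0 p0.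
      exists d => //= tau taud taut; apply: (dH (t - tau)); last by rewrite subr_gt0.
      by rewrite /= sub0r opprB distrC.
  - move=> x; rewrite in_itv/= => /andP[_ xt].
    by rewrite derive1E; have [_ ->] := dF x xt.
have mI : measurable_fun (`]a, t[%classic : set R)
    (fun tau : R => ((t - tau) `^ (p - 1))%:E).
  by apply/measurable_EFinP; exact: measurable_subr_powR.
apply/integrableP; split; first by apply/measurable_EFinP; exact: measurable_subr_powR.
rewrite (_ : (\int[mu]_(tau in _) _)%E = (F t - F a)%:E) ?ltry//.
rewrite -I (integral_itv_obnd_cbnd mI); apply: eq_integral => tau _.
by rewrite gee0_abs// lee_fin powR_ge0.
Qed.

Lemma within_continuous_bounded (R : realType) (a b : R) (f : R -> R) : a <= b ->
  {within `[a, b], continuous f} ->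
  exists M : R, forall x, x \in `[a, b] -> `|f x| <= M.
Proof.
move=> ab cf; have [c _ fc] := EVT_max ab cf; have [d _ fd] := EVT_min ab cf.
exists (`|f c| + `|f d|) => x xab; rewrite ler_norml; apply/andP; split.
  rewrite lerNl; apply: (@le_trans _ _ (- f d)); first by rewrite lerN2 fd.
  by apply: (le_trans (ler_norm _)); rewrite normrN lerDr.
by apply: (le_trans (fc x xab)); apply: (le_trans (ler_norm _)); rewrite lerDl.
Qed.

Lemma within_continuous_measurable_co (R : realType) (a t : R) (f : R -> R) :
  {within `[a, t], continuous f} -> measurable_fun (`[a, t[%classic : set R) f.
Proof.
move=> cf; apply: (@measurable_funS _ _ _ _ `[a, t]%classic).
- exact: measurable_itv.
- by move=> x /=; rewrite !in_itv/= => /andP[-> /ltW].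
- by apply: subspace_continuous_measurable_fun; [exact: measurable_itv|].
Qed.

(** Continuity of [f] up to [t] bounds it, so the singularity of the power is
    the only one. *)
Lemma integrable_abel_kernel (R : realType) (a t p : R) (f : R -> R) :
  a <= t -> 0 < p -> {within `[a, t], continuous f} ->
  mu.-integrable (`[a, t[%classic : set R)
    (EFin \o (fun tau : R => (t - tau) `^ (p - 1) * f tau)).
Proof.
move=> at_ p0 cf; have [M fM] := within_continuous_bounded at_ cf.
have mf := within_continuous_measurable_co cf.
have ip := integrableZl _ M (integrable_subr_powR at_ p0).
apply: (le_integrable _ _ _ (ip _)).
- exact: measurable_itv.
- apply/measurable_EFinP; apply: measurable_funM; last exact: mf.
  exact: measurable_subr_powR.
- move=> x /=; rewrite in_itv/= => /andP[ax xt].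
  have fx : `|f x| <= M by apply: fM; rewrite in_itv/= ax ltW.
  rewrite lee_fin normrM mulrC normrM ler_wpM2r//.
  by apply: (le_trans fx); exact: ler_norm.
- exact: measurable_itv.
Qed.

(** Passes from the half-open interval, on which the Laplace transforms
    converge, to the closed one of the definitions. *)
Lemma integral_co_Rintegral (R : realType) (a t : R) (g : R -> R) :
  mu.-integrable (`[a, t[%classic : set R) (EFin \o g) ->
  (\int[mu]_(x in `[a, t[) (g x)%:E = (\int[mu]_(x in `[a, t]) g x)%:E)%E.
Proof.
move=> ig; have mg := measurable_int _ ig.
have E := integral_itv_bndo_bndc mg; rewrite /Rintegral.
have -> : (\int[mu]_(x in `[a, t]) (g x)%:E = \int[mu]_(x in `[a, t[) (g x)%:E)%E.
  by rewrite -E.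
rewrite fineK//; apply: integrable_fin_num ig; exact: measurable_itv.
Qed.

Theorem theorem1 (R : realType) (a b : R) (hab : a < b)
    (f : R -> R) (hf : {within `[a, b], continuous f})
    (alpha : R) (halpha : 0 < alpha) (halphaN : alpha \isn't a Num.nat)
    (Omega : set R) (psi : R -> R) (hpsi : admissible Omega psi)
    (t : R) (ht : t \in `[a, b]) :
  (riemann_liouville a alpha f t)%:E =
  (\int[lebesgue_measure]_(w in Omega) (phi a alpha f psi t w)%:E)%E.
Proof.
have r := admissible_ray_param hpsi; have mO := ray_measurable r.
have [k [g /andP[g0 g1] [aE nE]]] := nat_shift_decomposition halpha halphaN.
pose be := 1 - g.
have be0 : 0 < be by rewrite /be subr_gt0.
have be1 : be < 1 by rewrite /be; lra.
have bE : (nceil alpha)%:R - alpha - 1 = be - 1.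
  by rewrite nE aE /be -natr1; ring.
have [aT tb] : a <= t /\ t <= b by move: ht; rewrite in_itv/= => /andP.
have cf : {within `[a, t], continuous f}.
  apply: continuous_subspaceW hf => x /=; rewrite !in_itv/= => /andP[-> xt].
  exact: le_trans tb.
have mf := within_continuous_measurable_co cf.
pose c := c_coef alpha.
pose p (w : R) := c * psi^`()%classic w * psi w `^ (be - 1).
pose q (tau : R) := (t - tau) ^+ k * f tau.
pose K (z : R * R) := (p z.1 * q z.2 * expR (- (psi z.1 * (t - z.2))))%:E.
(* The endpoint tau = t is left out: there, for n = 1,
   the integral of the kernel over Omega diverges. *)
pose E : set R := `[a, t[%classic.
have mE : measurable E by exact: measurable_itv.
have mpsi : measurable_fun Omega psi.
  apply: open_continuous_measurable_fun; first exact: (ray_open r).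
  by move=> w; rewrite inE => Ow; exact: (ray_continuous r).
have mp : measurable_fun Omega p.
  apply: measurable_funM.
    apply: measurable_funM; first exact: measurable_cst.
    apply: open_continuous_measurable_fun; first exact: (ray_open r).
    by move=> w; rewrite inE => Ow; exact: (ray_C1 r).
  exact: (measurableT_comp (measurable_powR _) mpsi).
have mt : measurable_fun E (fun tau : R => t - tau).
  by apply: measurable_funTS; exact: measurable_funB.
have mq : measurable_fun E q.
  by apply: measurable_funM => //; exact: measurable_funX.
have mK : measurable_fun (Omega `*` E) K.
  exact: (@measurable_laplace_kernel _ _ _ p q psi (fun tau => t - tau)).
have shift (tau : R) : E tau ->
    (t - tau) ^+ k * (t - tau) `^ (- be) = (t - tau) `^ (alpha - 1).
  rewrite /E/= in_itv/= => /andP[_ taut].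
  have s0 : 0 < t - tau by rewrite subr_gt0.
  rewrite -powR_mulrn ?ltW// -powRD; last by rewrite (gt_eqF s0) implybT.
  by congr (_ `^ _); rewrite aE /be; ring.
pose h (tau : R) := (t - tau) `^ (alpha - 1) * f tau.
have ih : mu.-integrable E (EFin \o h) by exact: integrable_abel_kernel.
have KE (tau : R) : E tau -> (\int[mu]_(w in Omega) K (w, tau) =
    (c * Gamma be * h tau)%:E)%E.
  move=> Et; have taut : 0 < t - tau.
    by move: Et; rewrite /E/= in_itv/= => /andP[_ ?]; rewrite subr_gt0.
  transitivity (c * q tau * ((t - tau) `^ (- be) * Gamma be))%:E; last first.
    by rewrite /h -(shift _ Et) /q; congr EFin; ring.
  rewrite -(ray_kernel_integral _ r taut be0 be1).
  apply: eq_integral => w _; rewrite /K /p/= (mulrC (psi w) (t - tau)).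
  by congr EFin; ring.
have absKE (tau : R) : E tau -> (\int[mu]_(w in Omega) `|K (w, tau)| =
    (`|c| * Gamma be * `|h tau|)%:E)%E.
  move=> Et; have taut : 0 < t - tau.
    by move: Et; rewrite /E/= in_itv/= => /andP[_ ?]; rewrite subr_gt0.
  transitivity (`|c| * `|q tau| * ((t - tau) `^ (- be) * Gamma be))%:E; last first.
    rewrite /h -(shift _ Et) /q !normrM (ger0_norm (powR_ge0 _ _)).
    by congr EFin; ring.
  rewrite -(ray_kernel_integral _ r taut be0 be1).
  apply: eq_integral => w; rewrite inE => Ow.
  rewrite /K /p/= !normrM (ger0_norm (powR_ge0 _ _)) (ger0_norm (expR_ge0 _)).
  rewrite (ger0_norm (ray_derive_ge0 r Ow)) (mulrC (psi w) (t - tau)).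
  by congr EFin; ring.
(* Absolute convergence: the integrals in the other order are explicit. *)
have absK : (\int[mu]_(w in Omega) \int[mu]_(tau in E) `|K (w, tau)| < +oo)%E.
  rewrite (tonelli_rect (k := fun z => `|K z|%E) mO mE); last first.
  - by move=> x y _ _; exact: abse_ge0.
  - exact: measurableT_comp.
  have -> : (\int[mu]_(tau in E) \int[mu]_(w in Omega) `|K (w, tau)| =
      \int[mu]_(tau in E) (`|c| * Gamma be * `|h tau|)%:E)%E.
    by apply: eq_integral => tau; rewrite inE; exact: absKE.
  apply: integrable_lty; first exact: measurable_itv.
  have := integrableZl _ (`|c| * Gamma be) (integrable_norm ih).
  by apply; exact: measurable_itv.
have phiE (w : R) : Omega w ->
    (phi a alpha f psi t w)%:E = (\int[mu]_(tau in E) K (w, tau))%E.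
  move=> Ow; pose G (tau : R) := (t - tau) ^+ k * expR (- ((t - tau) * psi w)) * f tau.
  have cG : {within `[a, t], continuous G}.
    have cs : continuous (fun tau : R => t - tau).
      by move=> x; apply: cvgB; [exact: cvg_cst|exact: cvg_id].
    have cg : continuous (fun tau : R => (t - tau) ^+ k * expR (- ((t - tau) * psi w))).
      move=> x; apply: cvgM.
        apply: (@continuous_comp _ _ _ (fun tau : R => t - tau) (fun y : R => y ^+ k)).
          exact: cs.
        exact: exprn_continuous.
      apply: (@continuous_comp _ _ _ (fun tau : R => t - tau)
        (fun y : R => expR (- (y * psi w)))).
        exact: cs.
      apply: continuous_comp; last exact: continuous_expR.
      by apply: cvgN; apply: cvgM; [exact: cvg_id|exact: cvg_cst].
    by move=> x; apply: cvgM; [exact: (continuous_subspaceT cg)|exact: cf].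
  have iG' : mu.-integrable (`[a, t]%classic : set R) (EFin \o G).
    by apply: continuous_compact_integrable => //; exact: segment_compact.
  have iG : mu.-integrable E (EFin \o G).
    apply: integrableS iG'.
    - exact: measurable_itv.
    - exact: measurable_itv.
    - by move=> x; rewrite /E/= !in_itv/= => /andP[-> /ltW].
  have -> : (\int[mu]_(tau in E) K (w, tau) =
      \int[mu]_(tau in E) ((p w)%:E * (G tau)%:E))%E.
    apply: eq_integral => tau _; rewrite /K /p /q /G -EFinM/= (mulrC (psi w) (t - tau)).
    by congr EFin; ring.
  rewrite integralZl; [|exact: measurable_itv|exact: iG].
  rewrite (integral_co_Rintegral iG) -EFinM /phi bE -/c nE.
  by [].
transitivity (\int[mu]_(w in Omega) \int[mu]_(tau in E) K (w, tau))%E; last first.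
  by apply: eq_integral => w; rewrite inE => Ow; rewrite phiE.
rewrite (fubini_rect mO mE mK absK).
have -> : (\int[mu]_(tau in E) \int[mu]_(w in Omega) K (w, tau) =
    \int[mu]_(tau in E) ((c * Gamma be)%:E * (h tau)%:E))%E.
  by apply: eq_integral => tau; rewrite inE => Et; rewrite (KE _ Et) EFinM.
rewrite integralZl; [|exact: measurable_itv|exact: ih].
rewrite (integral_co_Rintegral ih) -EFinM /riemann_liouville -/h.
have cG : Gamma alpha * (c * Gamma be) = 1.
  have := Gamma_shift_reflection k g0 g1; rewrite -aE -/be => H.
  by rewrite mulrA (mulrAC _ c) /c /c_coef nE.
have Ga0 : Gamma alpha != 0.
  by apply: contra_eq_neq cG => ->; rewrite mul0r eq_sym oner_neq0.
by congr (_ * _)%:E; rewrite -[LHS]mulr1 -cG mulKf.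
Qed.
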